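(* Consider the latent model described in the context, with the $\nu_{k\ell}$ independent of $Z$ and i.i.d. $\mathcal N(0,\lambda^2)$, $\lambda>0$, and let $x=x(Z)$ be a scalar function of $Z$. Let $\alpha\in\mathbb N^{n\times p}$ with $|\alpha|=2l$, and let $\mathcal P_2(\alpha)$ be the set of partitions $\pi=\{\pi_1,\dots,\pi_l\}$ of the multiset $\alpha$ (its $2l$ elements being regarded as distinguishable) with $|\pi_j|=2$ for all $j\in[l]$. Then the cumulant $\kappa_{x,\alpha}:=\mathrm{Cum}\big(x,\{X_{ij}\}_{(i,j)\in\alpha}\big)$ satisfies $$\kappa_{x,\alpha}=\lambda^{|\alpha|}\sum_{\pi\in\mathcal P_2(\alpha)}C_{x,\beta_1(\pi),\dots,\beta_l(\pi)},$$ where $[\beta_s(\pi)]_{ij}$ is the number of copies of $(i,j)$ in $\pi_s$ (so that $|\beta_1(\pi)|=\dots=|\beta_l(\pi)|=2$ and $\beta_1(\pi)+\dots+\beta_l(\pi)=\alpha$), and where, for $\beta_1,\dots,\beta_l\in\mathbb N^{n\times p}$ with $|\beta_s|=2$ and $\beta_1+\dots+\beta_l=\alpha$, $$C_{x,\beta_1,\dots,\beta_l}=\mathrm{Cum}\Big(x,\ \delta(Z)^{\beta_1}\mathbf 1_{\Omega_{\beta_1}(Z)},\ \dots,\ \delta(Z)^{\beta_l}\mathbf 1_{\Omega_{\beta_l}(Z)}\Big).$$ In particular, denoting $\beta[S]=\{\beta_s:s\in S\}$ for $S\subseteq[l]$, the cumulants $C_{x,\beta_1,\dots,\beta_l}$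 fulfill the recursive bound $$|C_{x,\beta_1,\dots,\beta_l}|\le \mathbb E\Big[|x|\,;\ \bigcap_{s\in[l]}\Omega_{\beta_s}(Z)\Big]+\sum_{S\subsetneq[l]}|C_{x,\beta[S]}|\ \mathbb P\Big[\bigcap_{s\in[l]\setminus S}\Omega_{\beta_s}(Z)\Big].$$
   Context: Notation: $[m]=\{1,\dots,m\}$. A matrix $\alpha\in\mathbb N^{n\times p}$ is identified with the multiset of $[n]\times[p]$ containing $\alpha_{ij}$ copies of $(i,j)$; $|\alpha|=\sum_{ij}\alpha_{ij}$. $\mathbb E[x;\mathcal B]=\mathbb E[x\mathbf 1_{\mathcal B}]$. Latent model: $Z$ is a random variable with values in a space $\mathcal Z$; $\delta_{ij}:\mathcal Z\to\{0,1,-1\}$ and $\theta_{ij}:\mathcal Z\to[K]\times[L]$ are given (measurable) maps for $(i,j)\in[n]\times[p]$; the signal matrix $X\in\mathbb R^{n\times p}$ is $X_{ij}=\delta_{ij}(Z)\,\nu_{\theta_{ij}(Z)}$. For $\beta\in\mathbb N^{n\times p}$: $\delta(Z)^\beta:=\prod_{(i,j)\in\beta}\delta_{ij}(Z)$ (with multiplicities) and $\Omega_\beta(Z):=\{\delta_{ij}(Z)\neq0,\ \forall(i,j)\in\beta\}\cap\{|\{\theta_{ij}(Z):(i,j)\in\beta\}|=1\}$. $\{X_{ij}\}_{(i,j)\in\alpha}$ is the multiset containing $\alpha_{ij}$ copies of $X_{ij}$. Joint cumulant: $\mathrm{Cum}(W_1,\dots,W_m)=\sum_{\pi}(-1)^{|\pi|-1}(|\pi|-1)!\prod_{R\in\pi}\mathbb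 E[\prod_{r\in R}W_r]$, sum over all partitions $\pi$ of $[m]$. For $S\subseteq[l]$, $C_{x,\beta[S]}=\mathrm{Cum}\big(x,(\delta(Z)^{\beta_s}\mathbf 1_{\Omega_{\beta_s}(Z)})_{s\in S}\big)$, with $C_{x,\beta[\emptyset]}=\mathbb E[x]$. The scalar $x$ is square-integrable. *)

(* Defs.v *)
From HB Require Import structures.
From mathcomp Require Import all_boot all_order all_algebra.
From mathcomp Require Import all_classical all_reals all_analysis.

Set Implicit Arguments.
Unset Strict Implicit.
Unset Printing Implicit Defensive.

Import Order.TTheory GRing.Theory Num.Theory.
Import numFieldNormedType.Exports.

Local Open Scope classical_set_scope.
Local Open Scope ring_scope.

(** Independence *)

Definition mutually_independent d d' (T : measurableType d)
    (T' : measurableType d') (R : realType) (P : probability T R)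
    (I : finType) (X : I -> {RV P >-> T'}) : Prop :=
  forall (J : {set I}) (B : I -> set T'),
    (forall i, i \in J -> measurable (B i)) ->
    P (\bigcap_(i in [set` J]) X i @^-1` B i)
    = (\prod_(i in J) P (X i @^-1` B i))%E.
Arguments mutually_independent {d d' T T' R} P {I} X.

Definition sigma_rv d d' (T : measurableType d) (T' : measurableType d')
    (X : T -> T') : set (set T) :=
  preimage_set_system setT X measurable.

Definition sigma_family d d' (T : measurableType d) (T' : measurableType d')
    (I : Type) (X : I -> T -> T') : set (set T) :=
  <<s \bigcup_i sigma_rv (X i) >>.

Definition independent_systems d (T : measurableType d) (R : realType)
    (P : probability T R) (F G : set (set T)) : Prop :=
  forall A B, F A -> G B -> P (A `&` B) = (P A * P B)%E.

(** Real-valued expectations and joint cumulants *)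

Definition Ex d (T : measurableType d) (R : realType) (P : probability T R)
    (f : T -> R) : R := fine 'E_P[f].

Definition Ex_on d (T : measurableType d) (R : realType) (P : probability T R)
    (f : T -> R) (B : set T) : R := Ex P (fun w => f w * \1_B w).

(* [Cum P A W] is the joint cumulant of the finite family [(W i)_(i in A)],
   where [A] is nonempty; it does not depend on an ordering of [A]. *)
Definition Cum d (T : measurableType d) (R : realType) (P : probability T R)
    (I : finType) (A : {set I}) (W : I -> T -> R) : R :=
  \sum_(pi : {set {set I}} | finset.partition pi A)
    (-1) ^+ (#|pi| - 1) * ((#|pi| - 1)`!)%:R *
    \prod_(B in pi) Ex P (fun w => \prod_(r in B) W r w).

(* [Cum1 P x A W] is [Cum(x, (W i)_(i in A))]: the index [None] carries [x]. *)
Definition Cum1 d (T : measurableType d) (R : realType) (P : probability T R)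
    (x : T -> R) (I : finType) (A : {set I}) (W : I -> T -> R) : R :=
  Cum P (None |: Some @: A)%SET (fun o : option I => oapp W x o).

(** Matrices of naturals as multisets *)

Definition msize (n p : nat) (alpha : 'M[nat]_(n, p)) : nat :=
  (\sum_i \sum_j alpha i j)%N.

Definition msupp (n p : nat) (alpha : 'M[nat]_(n, p)) : {set 'I_n * 'I_p} :=
  [set ij : 'I_n * 'I_p | (0 < alpha ij.1 ij.2)%N]%SET.

(* The elements of the multiset [alpha], with the [alpha i j] copies of
   [(i, j)] made distinguishable; [tag c] is the position of the copy [c]. *)
Definition copies (n p : nat) (alpha : 'M[nat]_(n, p)) : finType :=
  {ij : 'I_n * 'I_p & 'I_(alpha ij.1 ij.2)}.

Definition pairings (n p : nat) (alpha : 'M[nat]_(n, p)) :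
    {set {set {set copies alpha}}} :=
  [set pi | finset.partition pi [set: copies alpha]
            & [forall B in pi, #|B| == 2%N]]%SET.

Definition beta_of (n p : nat) (alpha : 'M[nat]_(n, p))
    (B : {set copies alpha}) : 'M[nat]_(n, p) :=
  \matrix_(i, j) #|[set c in B | tag c == (i, j)]%SET|.

(** The latent model *)

Definition signal d d' (T : measurableType d) (Zt : measurableType d')
    (R : realType) (n p K L : nat) (Z : T -> Zt)
    (delta : 'I_n -> 'I_p -> Zt -> R)
    (theta : 'I_n -> 'I_p -> Zt -> 'I_K * 'I_L)
    (nu : 'I_K * 'I_L -> T -> R) (i : 'I_n) (j : 'I_p) (w : T) : R :=
  delta i j (Z w) * nu (theta i j (Z w)) w.

Definition delta_pow (Zt : Type) (R : realType) (n p : nat)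
    (delta : 'I_n -> 'I_p -> Zt -> R) (beta : 'M[nat]_(n, p)) (z : Zt) : R :=
  \prod_i \prod_j delta i j z ^+ beta i j.

Definition Omega (Zt : Type) (R : realType) (n p K L : nat)
    (delta : 'I_n -> 'I_p -> Zt -> R)
    (theta : 'I_n -> 'I_p -> Zt -> 'I_K * 'I_L)
    (beta : 'M[nat]_(n, p)) : set Zt :=
  [set z | forall ij, ij \in msupp beta -> delta ij.1 ij.2 z != 0] `&`
  [set z | #|(fun ij => theta ij.1 ij.2 z) @: msupp beta| = 1%N].

(* [C_{x, (beta s)_(s in S)}]; for [S] empty it is [E[x]], see [C_x_set0]. *)
Definition C_x d d' (T : measurableType d) (Zt : measurableType d')
    (R : realType) (P : probability T R) (n p K L : nat) (Z : T -> Zt)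
    (delta : 'I_n -> 'I_p -> Zt -> R)
    (theta : 'I_n -> 'I_p -> Zt -> 'I_K * 'I_L)
    (x : Zt -> R) (I : finType) (beta : I -> 'M[nat]_(n, p)) (S : {set I}) :
    R :=
  Cum1 P (fun w => x (Z w)) S
    (fun s w => delta_pow delta (beta s) (Z w) *
                \1_(Omega delta theta (beta s)) (Z w)).

Lemma Cum1_set0 d (T : measurableType d) (R : realType) (P : probability T R)
    (x : T -> R) (I : finType) (W : I -> T -> R) :
  Cum1 P x finset.set0 W = Ex P x.
Proof.
rewrite /Cum1 imset0 finset.setU0 /Cum.
rewrite (bigD1 [set [set None]]%SET) /=; last first.
  rewrite /finset.partition /finset.trivIset /finset.cover !big_set1 cards1.
  rewrite !eqxx /= finset.in_set1 eq_sym.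
  by apply/finset.set0Pn; exists None; rewrite finset.in_set1.
rewrite [X in _ + X]big1 ?addr0.
  rewrite cards1 subnn expr0 fact0 !mul1r big_set1; congr (Ex P _).
  by apply/funext => w; rewrite big_set1.
move=> pi /andP[/and3P[/eqP cov _ n0]] /eqP[]; apply/finset.setP => B.
have sub C : C \in pi -> C = [set None]%SET.
  move=> Cpi; 
  have : C \subset [set None]%SET by rewrite -cov; apply: (finset.bigcup_sup C).
  rewrite finset.subset1 => /orP[/eqP//|/eqP C0].
  by move: n0; rewrite -C0 Cpi.
rewrite finset.in_set1; apply/idP/eqP => [/sub//|->].
have : None \in finset.cover pi by rewrite cov finset.in_set1.
by move=> /bigcupP[C Cpi _]; rewrite -(sub _ Cpi).
Qed.

Lemma C_x_set0 d d' (T : measurableType d) (Zt : measurableType d')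
    (R : realType) (P : probability T R) (n p K L : nat) (Z : T -> Zt)
    (delta : 'I_n -> 'I_p -> Zt -> R)
    (theta : 'I_n -> 'I_p -> Zt -> 'I_K * 'I_L)
    (x : Zt -> R) (I : finType) (beta : I -> 'M[nat]_(n, p)) :
  C_x P Z delta theta x beta finset.set0 = Ex P (fun w => x (Z w)).
Proof. exact: Cum1_set0. Qed.

(* Main.v *)
(* Moments and cumulants are related by
   E[x prod_(i in A) W_i]
     = sum_(S \subset A) Cum(x, W_i : i in S) * E[prod_(i in A :\: S) W_i],
   and this recursion determines the cumulants.  Now
   conditioning on the values of [theta] and applying Isserlis' formula turns
   the mixed moments of the entries of the signal over a set [A] of copies into
   lambda^|A| times the sum over the pairings of [A] of the mixed moments of the
   variables delta^beta 1_Omega attached to the pairs.  Since a pairing of [A]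
   with a distinguished subset of its pairs is a pairing of some [S \subset A]
   together with a pairing of [A :\: S], the right-hand sides of the claimed
   formula obey the recursion of the cumulants of the signal.  The recursive
   bound is the same recursion solved for its term [S = A]. *)

Require Import Defs.
From HB Require Import structures.
From mathcomp Require Import all_boot all_order all_algebra.
From mathcomp Require Import all_classical all_reals all_analysis.
From mathcomp Require Import measurable_realfun.
From mathcomp Require Import ring lra.

Set Implicit Arguments.
Unset Strict Implicit.
Unset Printing Implicit Defensive.

Import Order.TTheory GRing.Theory Num.Theory.
Import numFieldNormedType.Exports.

Local Open Scope classical_set_scope.
Local Open Scope ring_scope.

(** * Cumulants and partitions *)

Lemma partitionD_notin (U : finType) (A B : {set U}) (pi : {set {set U}}) :
  B != finset.set0 -> finset.partition pi (A :\: B)%SET -> B \notin pi.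
Proof.
move=> /finset.set0Pn[b Bb] pAB; apply/negP => Bpi.
have /fintype.subsetP/(_ b Bb) := partitionS pAB Bpi.
by rewrite !inE Bb.
Qed.

Lemma partition_setU1 (U : finType) (A B : {set U}) (pi : {set {set U}}) :
  B != finset.set0 -> B \subset A -> B \notin pi ->
  finset.partition (B |: pi)%SET A = finset.partition pi (A :\: B)%SET.
Proof.
move=> B0 BA Bpi; apply/idP/idP => [pA|pAB].
  rewrite -(finset.setU1K Bpi); apply: partitionD1 => //.
  by rewrite finset.setU11.
have -> : A = B :|: (A :\: B).
  apply/finset.setP => u; rewrite !inE.
  by case: (boolP (u \in B)) => // /(fintype.subsetP BA) ->.
apply: finset.partitionU1 => //.
by rewrite -finset.setI_eq0; apply/eqP/finset.setP => u; rewrite !inE; case: (u \in B).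
Qed.

(** Inserting and removing the block [B] are mutually inverse maps between the partitions of
    [A :\: B] and the partitions of [A] that have [B] as a block. *)
Lemma sum_partition_block (U : finType) (R : nmodType) (A B : {set U})
    (F : {set {set U}} -> R) : B != finset.set0 -> B \subset A ->
  \sum_(pi | finset.partition pi A && (B \in pi)) F pi
  = \sum_(pi | finset.partition pi (A :\: B)%SET) F (B |: pi)%SET.
Proof.
move=> B0 BA.
rewrite (reindex_onto (fun pi => B |: pi)%SET (fun pi => pi :\ B)%SET); last first.
  by move=> pi /andP[_ Bpi]; rewrite finset.setD1K.
apply: eq_bigl => pi; rewrite finset.setU11 andbT.
apply/andP/idP => [[pA /eqP E]|pAB].
  have Bpi : B \notin pi by rewrite -E !inE eqxx.
  by rewrite -partition_setU1.
have Bpi := partitionD_notin B0 pAB.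
by rewrite partition_setU1 // finset.setU1K.
Qed.

(** The partition formula of [Cum] with an arbitrary set function [m] in the role of the mixed
    moments, so that its inversion is pure combinatorics. *)
Definition cumulant_of (U : finType) (R : pzRingType) (m : {set U} -> R)
    (A : {set U}) : R :=
  \sum_(pi | finset.partition pi A)
    (-1) ^+ (#|pi| - 1) * ((#|pi| - 1)`!)%:R * \prod_(B in pi) m B.

(* A partition [pi] of [A] arises once from [A] itself, with its Moebius
   coefficient, and once for every block not containing [a], the coefficient
   being that of [pi] with this block removed; these cancel unless [#|pi| = 1]. *)
Lemma moment_cumulant (U : finType) (R : comPzRingType) (m : {set U} -> R)
    (A : {set U}) (a : U) : m finset.set0 = 1 -> a \in A ->
  m A = \sum_(B : {set U} | (B \subset A) && (a \notin B))
          cumulant_of m (A :\: B)%SET * m B.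
Proof.
move=> m0 aA.
(* The Moebius coefficient of a partition with [k + 1] blocks. Removing a block from [pi] leaves
   [#|pi| - 1] of them, hence [c (#|pi| - 2)] below. *)
pose c (k : nat) : R := (-1) ^+ k * (k`!)%:R.
rewrite (bigD1 finset.set0) /=; last by rewrite finset.sub0set finset.in_set0.
rewrite finset.setD0 m0 mulr1.
transitivity (cumulant_of m A +
  \sum_(pi | finset.partition pi A)
    (c (#|pi| - 2)%N * \prod_(B in pi) m B) *+ (#|pi| - 1)); last first.
  congr (_ + _).
  transitivity (\sum_(B : {set U} | (B \subset A) && (a \notin B) && (B != finset.set0))
     \sum_(pi | finset.partition pi A && (B \in pi))
       (c (#|pi| - 2)%N * \prod_(C in pi) m C)).
    rewrite (exchange_big_dep (fun pi => finset.partition pi A)) /=; last first.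
      by move=> B pi _ /andP[].
    apply: eq_bigr => pi pA.
    have cov : finset.cover pi = A by exact: finset.cover_partition.
    have tri := finset.partition_trivIset pA.
    have pbl : finset.pblock pi a \in pi by apply: finset.pblock_mem; rewrite cov.
    (* The blocks that may be removed are all but the one containing [a]. *)
    rewrite sumr_const; congr (_ *+ _).
    transitivity #|pi :\ finset.pblock pi a|.
      by rewrite (cardsD1 (finset.pblock pi a) pi) pbl addKn.
    apply: eq_card => B; rewrite !inE.
    apply/andP/andP => [[Ba Bpi]|[/andP[/andP[BA aB] B0] /andP[_ Bpi]]]; last first.
      split=> //; apply: contraNneq aB => ->.
      by rewrite finset.mem_pblock cov.
    rewrite Bpi pA (partitionS pA Bpi) (partition_neq0 pA Bpi) !andbT; split=> //.
    by apply: contra Ba => aB; rewrite (finset.def_pblock tri Bpi aB).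
  apply: eq_bigr => B /andP[/andP[BA aB] B0].
  rewrite sum_partition_block // /cumulant_of big_distrl /=.
  apply: eq_bigr => pi pAB; have Bpi := partitionD_notin B0 pAB.
  rewrite big_setU1 //= cardsU1 Bpi add1n subSS -!mulrA; congr (_ * _).
  by rewrite mulrCA mulrC mulrA.
rewrite /cumulant_of -big_split /=.
rewrite (bigD1 [set A]%SET) /=; last first.
  rewrite /finset.partition /finset.cover finset.trivIset1 big_set1 eqxx /=.
  by rewrite inE eq_sym; apply/finset.set0Pn; exists a.
rewrite cards1 big_set1 subnn mulr0n addr0 expr0 fact0 !mul1r big1 ?addr0 //.
move=> pi /andP[pA piA].
have : (1 < #|pi|)%N.
  rewrite ltn_neqAle lt0n finset.cards_eq0; apply/andP; split.
    apply: contra piA; rewrite eq_sym => /cards1P[C piC].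
    by have := finset.cover_partition pA; rewrite piC /finset.cover big_set1 => ->.
  apply: contraL aA => /eqP pi0; have := finset.cover_partition pA.
  by rewrite pi0 /finset.cover big_set0 => <-; rewrite inE.
(* With [#|pi| = k + 2] the two coefficients are [(-1)^(k+1) (k+1)!] and [(k+1) (-1)^k k!], which
   cancel. *)
case: #|pi| => [//|[//|k]] _; rewrite !subSS !subn0 factS natrM exprS /c.
by rewrite -mulr_natl; ring.
Qed.

(** * Mixed moments of random variables and their recursion *)

Definition mom d (T : measurableType d) (R : realType) (P : probability T R)
    (I : finType) (A : {set I}) (W : I -> T -> R) : R :=
  Ex P (fun w => \prod_(i in A) W i w).

Definition mom1 d (T : measurableType d) (R : realType) (P : probability T R)
    (x : T -> R) (I : finType) (A : {set I}) (W : I -> T -> R) : R :=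
  Ex P (fun w => x w * \prod_(i in A) W i w).

Lemma mom_set0 d (T : measurableType d) (R : realType) (P : probability T R)
    (I : finType) (W : I -> T -> R) : mom P finset.set0 W = 1.
Proof.
rewrite /mom; under eq_fun do rewrite big_set0.
by rewrite /Ex expectation_cst.
Qed.

(** This is [moment_cumulant] on the indices extended by [None], the carrier of [x], taken as the
    distinguished element: [S] collects the companions of [x], and the complementary set never
    contains [None]. *)
Lemma mom1_Cum1 d (T : measurableType d) (R : realType) (P : probability T R)
    (x : T -> R) (I : finType) (A : {set I}) (W : I -> T -> R) :
  mom1 P x A W
  = \sum_(S : {set I} | S \subset A) Cum1 P x S W * mom P (A :\: S)%SET W.
Proof.
pose W' (o : option I) := oapp W x o.
have := @moment_cumulant _ _ (fun A => mom P A W') (None |: Some @: A)%SET None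
  (mom_set0 P W') (finset.setU11 _ _).
have SomeI : injective (@Some I) by move=> ? ? [].
have NA (B : {set I}) : None \notin (Some @: B)%SET by apply/finset.imsetP => -[].
rewrite [X in X = _ -> _](_ : _ = mom1 P x A W); last first.
  congr (Ex P _); apply/funext => w; rewrite big_setU1 //= big_imset //=.
  by move=> ? ? _ _ [].
move=> ->.
(* The sets avoiding [None] are the images under [Some] of the complements of [S] in [A]. *)
rewrite (reindex_onto (fun S : {set I} => Some @: (A :\: S))%SET
  (fun B => A :\: Some @^-1: B)%SET) /=; last first.
  move=> B /andP[/fintype.subsetP BA NB]; apply/finset.setP => -[i|]; last first.
    by rewrite (negbTE NB); apply/negbTE/NA.
  rewrite mem_imset // !inE negb_and negbK.
  case: (boolP (Some i \in B)) => [iB|_]; last by case: (i \in A).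
  by have := BA _ iB; rewrite !inE /= mem_imset // => ->.
apply: eq_big => [S|S].
  rewrite NA andbT; apply/andP/idP => [[_ /eqP <-]|SA]; first by apply: finset.subsetDl.
  split.
    apply/fintype.subsetP => o /finset.imsetP[i /finset.setDP[iA _] ->].
    by rewrite !inE /= mem_imset.
  apply/eqP/finset.setP => i; rewrite !inE mem_imset // !inE negb_and negbK.
  by case: (boolP (i \in S)) => [/(fintype.subsetP SA) ->|_] //; case: (i \in A).
move=> /andP[_ /eqP E].
have SA : S \subset A by rewrite -E; apply: finset.subsetDl.
congr (_ * _); last first.
  by congr (Ex P _); apply/funext => w; rewrite big_imset //= => ? ? _ _ [].
rewrite /Cum1 /Cum /cumulant_of.
apply: eq_bigl => pi; congr (finset.partition pi _); apply/finset.setP => -[i|].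
  rewrite !inE /= !mem_imset // !inE negb_and negbK.
  by case: (boolP (i \in S)) => [/(fintype.subsetP SA) ->|_] //; case: (i \in A).
by rewrite !inE /= andbT; apply: NA.
Qed.

(** * Pairings *)

(** Stated for an arbitrary subset [A], since the recursions descend to subsets; at the full set of
    copies it is membership in [pairings]. *)
Definition pairing (U : finType) (A : {set U}) (pi : {set {set U}}) : bool :=
  finset.partition pi A && [forall B in pi, #|B| == 2%N].

Lemma pairingP (U : finType) (A : {set U}) (pi : {set {set U}}) :
  reflect (finset.partition pi A /\ {in pi, forall B : {set U}, #|B| = 2%N})
          (pairing A pi).
Proof.
apply: (iffP andP) => -[pA].
  by move=> /forall_inP H; split=> // B /H /eqP.
by move=> H; split=> //; apply/forall_inP => B /H /eqP.
Qed.

Lemma pairing_set0 (U : finType) (pi : {set {set U}}) :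
  pairing finset.set0 pi = (pi == finset.set0).
Proof.
rewrite /pairing partition_set0; case: eqVneq => //= ->.
by apply/forall_inP => B; rewrite inE.
Qed.

Lemma pairing_card (U : finType) (A : {set U}) (pi : {set {set U}}) :
  pairing A pi -> #|A| = (#|pi| * 2)%N.
Proof. by move=> /pairingP[pA pi2]; apply: finset.card_uniform_partition. Qed.

Lemma sum_pairing_block (U : finType) (R : nmodType) (A : {set U}) (a b : U)
    (F : {set {set U}} -> R) : a \in A -> b \in A -> a != b ->
  \sum_(pi | pairing A pi && ([set a; b]%SET \in pi)) F pi
  = \sum_(pi | pairing (A :\: [set a; b])%SET pi) F ([set a; b] |: pi)%SET.
Proof.
move=> aA bA ab; set B := [set a; b]%SET.
have B0 : B != finset.set0 by apply/finset.set0Pn; exists a; rewrite !inE eqxx.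
have BA : B \subset A by apply/fintype.subsetP => c; rewrite !inE => /orP[] /eqP ->.
under eq_bigl do rewrite -andbA [X in _ && X]andbC andbA.
rewrite big_mkcondr (sum_partition_block _ B0 BA) -big_mkcondr.
apply: eq_bigl => pi; rewrite /pairing; congr (_ && _).
apply/forall_inP/forall_inP => H C Cpi; first by apply: H; rewrite inE Cpi orbT.
by move: Cpi; rewrite !inE => /orP[/eqP ->|/H //]; rewrite cards2 ab.
Qed.

(** In a pairing, [a] has exactly one partner [b]; the pairings of [A] are sorted by this
    partner. *)
Lemma sum_pairing_rec (U : finType) (R : nmodType) (A : {set U}) (a : U)
    (F : {set {set U}} -> R) : a \in A ->
  \sum_(pi | pairing A pi) F pi
  = \sum_(b in (A :\ a)%SET)
      \sum_(pi | pairing (A :\: [set a; b])%SET pi) F ([set a; b] |: pi)%SET.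
Proof.
move=> aA.
transitivity (\sum_(b in (A :\ a)%SET)
    \sum_(pi | pairing A pi && ([set a; b]%SET \in pi)) F pi); last first.
  apply: eq_bigr => b; rewrite !inE => /andP[ba bA].
  by rewrite sum_pairing_block // eq_sym.
rewrite (exchange_big_dep (pairing A)) /=; last by move=> b pi _ /andP[].
apply: eq_bigr => pi /[dup] piA /pairingP[pA pi2].
have cov := finset.cover_partition pA.
have tri := finset.partition_trivIset pA.
have Bpi : finset.pblock pi a \in pi by apply: finset.pblock_mem; rewrite cov.
have aB : a \in finset.pblock pi a by rewrite finset.mem_pblock cov.
have /cards1P[b Bb] : #|finset.pblock pi a :\ a| == 1%N.
  by rewrite -(eqn_add2l 1) -{1}[1%N]/(true : nat) -{1}aB -cardsD1 pi2.
have Bab : finset.pblock pi a = [set a; b]%SET.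
  by rewrite -(finset.setD1K aB) Bb.
have /finset.setD1P[ba _] : b \in (finset.pblock pi a :\ a)%SET by rewrite Bb inE.
rewrite (big_pred1 b) // => c /=.
rewrite !inE piA /=; apply/andP/eqP => [[/andP[ca cA] cpi]|->]; last first.
  rewrite -Bab Bpi ba; split=> //.
  by apply: (fintype.subsetP (partitionS pA Bpi)); rewrite Bab !inE eqxx orbT.
have : c \in finset.pblock pi a.
  by rewrite (finset.def_pblock tri cpi) !inE eqxx ?orbT.
by rewrite Bab !inE (negbTE ca) => /eqP.
Qed.

(** The equation on the right expresses that the two families are disjoint, in the form asked for by
    the change of variables [pi = pi1 :|: pi2]. Disjoint covers force disjoint families because
    blocks are nonempty. *)
Lemma pairing_setU (U : finType) (A : {set U}) (pi1 pi2 : {set {set U}}) :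
  [&& finset.cover pi1 \subset A, pairing (finset.cover pi1) pi1
    & pairing (A :\: finset.cover pi1)%SET pi2]
  = pairing A (pi1 :|: pi2)%SET && ((pi1 :|: pi2) :\: pi1 == pi2)%SET.
Proof.
apply/and3P/andP => [[cA /pairingP[p1 c1] /pairingP[p2 c2]]|].
  have [/eqP cov1 tri1 n1] := and3P p1; have [/eqP cov2 tri2 n2] := and3P p2.
  have dis : fintype.disjoint (mem (finset.cover pi1)) (mem (finset.cover pi2)).
    rewrite cov2 -finset.setI_eq0; apply/eqP/finset.setP => u.
    by rewrite !inE; case: (u \in _).
  split.
    apply/pairingP; split; last by move=> B; rewrite inE => /orP[/c1|/c2].
    apply/and3P; split.
    - have -> : finset.cover (pi1 :|: pi2)
          = (finset.cover pi1 :|: finset.cover pi2)%SET.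
        exact: finset.bigcup_setU.
      rewrite cov2; apply/eqP/finset.setP => u; rewrite !inE.
      by case: (boolP (u \in finset.cover pi1)) => [/(fintype.subsetP cA) ->|].
    - exact: finset.trivIsetU.
    - by rewrite inE negb_or n1.
  apply/eqP/finset.setP => B; rewrite !inE andb_orr andNb /=.
  case: (boolP (B \in pi2)) => B2; rewrite ?andbF // andbT.
  apply/negP => B1; have /finset.set0Pn[b bB] := partition_neq0 p1 B1.
  have : b \in (A :\: finset.cover pi1)%SET.
    by apply: (fintype.subsetP (partitionS p2 B2)).
  by rewrite inE (fintype.subsetP (partitionS p1 B1)).
move=> [/pairingP[p c] /eqP D]; have [/eqP cov tri n0] := and3P p.
have sub1 B : B \in pi1 -> B \in (pi1 :|: pi2)%SET by move=> B1; rewrite inE B1.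
have sub2 B : B \in pi2 -> B \in (pi1 :|: pi2)%SET by move=> B1; rewrite inE B1 orbT.
have covU : (finset.cover pi1 :|: finset.cover pi2)%SET = A.
  by rewrite -cov /finset.cover finset.bigcup_setU.
split.
- by rewrite -covU finset.subsetUl.
- apply/pairingP; split; last by move=> B /sub1 /c.
  apply/and3P; split=> //; last by apply: contra n0 => /sub1.
  by apply: finset.trivIsetS tri; apply: finset.subsetUl.
- apply/pairingP; split; last by move=> B /sub2 /c.
  apply/and3P; split; last by apply: contra n0 => /sub2.
    apply/eqP; rewrite -covU finset.setDUl finset.setDv finset.set0U.
    apply/esym/finset.setDidPl; rewrite -finset.setI_eq0.
    apply/eqP/finset.setP => u; rewrite !inE; apply/negP.
    move=> /andP[/finset.bigcupP[B B2 uB] /finset.bigcupP[C C1 uC]].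
    have := finset.def_pblock tri (sub2 _ B2) uB.
    rewrite (finset.def_pblock tri (sub1 _ C1) uC) => BC.
    by move: B2; rewrite -BC -D inE C1.
  by apply: finset.trivIsetS tri; apply: finset.subsetUr.
Qed.

(** A pairing [pi1] of [S] determines [S] as its cover, so the sum over [S] collapses; the remaining
    couples [(pi1, pi2)] correspond to their union [pi] with the marked subfamily [pi1]. *)
Lemma sum_pairing_split (U : finType) (R : nmodType) (A : {set U})
    (F : {set {set U}} -> {set {set U}} -> R) :
  \sum_(S : {set U} | S \subset A) \sum_(pi1 | pairing S pi1)
    \sum_(pi2 | pairing (A :\: S)%SET pi2) F pi1 pi2
  = \sum_(pi | pairing A pi)
      \sum_(pi1 : {set {set U}} | pi1 \subset pi) F pi1 (pi :\: pi1)%SET.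
Proof.
transitivity (\sum_(pi1 : {set {set U}}) \sum_(pi2 |
    [&& finset.cover pi1 \subset A, pairing (finset.cover pi1) pi1
      & pairing (A :\: finset.cover pi1)%SET pi2]) F pi1 pi2).
  rewrite (exchange_big_dep predT) //=; apply: eq_bigr => pi1 _.
  have covE S : pairing S pi1 -> S = finset.cover pi1.
    by move=> /pairingP[/finset.cover_partition].
  have [/andP[cA p1]|ncp] := boolP ((finset.cover pi1 \subset A) &&
      pairing (finset.cover pi1) pi1).
    rewrite (big_pred1 (finset.cover pi1)) => [|S /=]; last first.
      apply/andP/eqP => [[_ /covE //]|->//].
    by apply: eq_bigl => pi2; rewrite cA p1.
  rewrite [RHS]big_pred0 => [|pi2]; last by rewrite andbA (negbTE ncp).
  rewrite big_pred0 // => S; apply/negbTE; apply: contra ncp => /andP[SA Sp].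
  by rewrite -(covE _ Sp) SA.
rewrite [RHS](exchange_big_dep predT) //=; apply: eq_bigr => pi1 _.
rewrite [RHS](reindex_onto (fun pi2 => pi1 :|: pi2)%SET
  (fun pi => pi :\: pi1)%SET) /=; last first.
  move=> pi /andP[_ sub]; apply/finset.setP => B; rewrite !inE.
  by case: (boolP (B \in pi1)) => [/(fintype.subsetP sub) ->|].
apply: eq_big => [pi2|pi2]; last by rewrite pairing_setU => /andP[_ /eqP ->].
by rewrite pairing_setU finset.subsetUl andbT.
Qed.

(* Integration by parts pairs a given copy [a] with each remaining copy [b] of
   the same variable, which is how a pairing of [A] is built from one of
   [A :\: [set a; b]]. *)
Lemma isserlis (U J : finType) (R : comPzRingType) (s : R) (M : J -> nat -> R)
    (t : U -> J) (A : {set U}) : (forall k, M k 0%N = 1) ->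
  (forall k m, M k m.+1 = s ^+ 2 * (m%:R * M k m.-1)) ->
  \prod_k M k #|[set c in A | t c == k]%SET|
  = s ^+ #|A| * \sum_(pi | pairing A pi) \prod_(B in pi) (#|t @: B| == 1%N)%:R.
Proof.
(* The induction is on a bound for the size, since each step removes two elements of [A]. *)
move=> M0 MS; move: {2}#|A| (leqnn #|A|) => n.
elim: n A => [|n IH] A.
  rewrite leqn0 finset.cards_eq0 => /eqP ->.
  rewrite finset.cards0 expr0 mul1r (big_pred1 finset.set0) => [|pi]; last first.
    by rewrite pairing_set0.
  rewrite big_set0 big1 // => k _; rewrite -(M0 k); congr M; apply: eq_card0 => c.
  by rewrite !inE.
move=> An; have [->|/finset.set0Pn[a aA]] := eqVneq A finset.set0.
  by apply: IH; rewrite finset.cards0.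
rewrite (sum_pairing_rec _ aA) (bigD1 (t a)) //=.
pose m := #|[set c in (A :\ a)%SET | t c == t a]%SET|.
have -> : #|[set c in A | t c == t a]%SET| = m.+1.
  rewrite (cardsD1 a) !inE aA eqxx /=; congr _.+1; apply: eq_card => c.
  by rewrite !inE andbA.
rewrite MS; pose Q := \prod_(k | k != t a) M k #|[set c in A | t c == k]%SET|.
rewrite -/Q.
(* The factor [m%:R] counts the possible partners [b] of [a], those with the same label; for [m = 0]
   it vanishes, so the value of [m.-1] there is immaterial. *)
transitivity (\sum_(b in (A :\ a)%SET)
    (t a == t b)%:R * (s ^+ 2 * (M (t a) m.-1 * Q))).
  have mE : m%:R = \sum_(b in (A :\ a)%SET) (t a == t b)%:R :> R.
    rewrite -natr_sum; congr _%:R.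
    rewrite /m -sum1_card big_mkcond [RHS]big_mkcond; apply: eq_bigr => c _.
    rewrite !inE [t a == _]eq_sym.
    by case: (c != a) => //=; case: (c \in A) => //=; case: (t c == t a).
  by rewrite -big_distrl /= -mE; ring.
rewrite big_distrr /=; apply: eq_bigr => b /finset.setD1P[ba bA].
have abA : [set a; b]%SET \subset A.
  by apply/fintype.subsetP => c; rewrite !inE => /orP[] /eqP ->.
have cAB : #|A| = #|A :\: [set a; b]%SET|.+2.
  rewrite -(finset.cardsID [set a; b]%SET A) (finset.setIidPr abA).
  by rewrite cards2 eq_sym ba.
transitivity (s ^+ #|A| * ((t a == t b)%:R *
  \sum_(pi | pairing (A :\: [set a; b])%SET pi)
     \prod_(B in pi) ((#|t @: B| == 1%N)%:R : R))); last first.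
  congr (_ * _); rewrite big_distrr /=; apply: eq_bigr => pi /pairingP[pA _].
  rewrite big_setU1 /=; last first.
    apply: partitionD_notin pA.
    by apply/finset.set0Pn; exists a; rewrite !inE eqxx.
  congr (_ * _); rewrite imsetU1 imset_set1 cards2.
  by case: eqP.
case: eqP => [tab|_]; last by rewrite !mul0r mulr0.
rewrite !mul1r cAB -add2n (exprD s 2 #|(A :\: [set a; b])%SET|).
rewrite -[RHS]mulrA -IH; last first.
  by rewrite -ltnS; apply: leq_trans An; rewrite cAB.
(* Removing [a] and [b] leaves [m - 1] elements with their common label and does not change the
   multiplicity of any other label. *)
congr (_ * _); rewrite [RHS](bigD1 (t a)) //=; congr (_ * _).
  congr M; rewrite /m (cardsD1 b) !inE ba bA tab eqxx /=; apply: eq_card => c.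
  by rewrite !inE negb_or; case: (c == a); case: (c == b).
apply: eq_bigr => k ka; congr M; apply: eq_card => c; rewrite !inE negb_or.
have [->|_] := eqVneq c a; first by rewrite eq_sym (negbTE ka) !andbF.
have [->|_] := eqVneq c b; first by rewrite -tab eq_sym (negbTE ka) !andbF.
by [].
Qed.

Lemma prod_comp_exp (U J : finType) (R : comPzRingType) (t : U -> J)
    (A : {set U}) (F : J -> R) :
  \prod_(c in A) F (t c) = \prod_k F k ^+ #|[set c in A | t c == k]%SET|.
Proof.
rewrite (partition_big t predT) //=; apply: eq_bigr => k _.
rewrite -prodr_const; apply: eq_big => c; first by rewrite !inE.
by move=> /andP[_ /eqP ->].
Qed.

(** Here [kap], [m1], [m] stand for the cumulants and the moments with and without [x] of the
    signal, and [c], [mu1], [mu] for those of the variables attached to the pairs. The recursion is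
    triangular with diagonal entry [m finset.set0 = 1], so it has a single solution. *)
Lemma cumulant_pairing (U : finType) (R : comPzRingType) (s : R)
    (kap m1 m : {set U} -> R) (c mu1 mu : {set {set U}} -> R) :
  (forall A, m1 A = \sum_(S : {set U} | S \subset A) kap S * m (A :\: S)%SET) ->
  (forall pi, mu1 pi
     = \sum_(pi' : {set {set U}} | pi' \subset pi) c pi' * mu (pi :\: pi')%SET) ->
  (forall A, m1 A = s ^+ #|A| * \sum_(pi | pairing A pi) mu1 pi) ->
  (forall A, m A = s ^+ #|A| * \sum_(pi | pairing A pi) mu pi) ->
  m finset.set0 = 1 ->
  forall A, kap A = s ^+ #|A| * \sum_(pi | pairing A pi) c pi.
Proof.
move=> m1E mu1E m1P mP m0 A.
pose K (S : {set U}) := s ^+ #|S| * \sum_(pi | pairing S pi) c pi.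
have m1K B : m1 B = \sum_(S : {set U} | S \subset B) K S * m (B :\: S)%SET.
  rewrite m1P; under eq_bigr do rewrite mu1E.
  rewrite -(sum_pairing_split B (fun pi1 pi2 => c pi1 * mu pi2)) big_distrr /=.
  apply: eq_bigr => S SB; rewrite mP /K mulrACA -exprD.
  have -> : (#|S| + #|(B :\: S)%SET| = #|B|)%N.
    by rewrite -(finset.cardsID S B) (finset.setIidPr SB).
  by rewrite big_distrlr.
rewrite -/(K A); move: {2}#|A| (leqnn #|A|) => n.
elim: n A => [|n IH] A An.
  have A0 : A = finset.set0 by apply/eqP; rewrite -finset.cards_eq0 -leqn0.
  have E (G : {set U} -> R) :
      \sum_(S : {set U} | S \subset finset.set0) G S = G finset.set0.
    by apply: big_pred1 => S; rewrite finset.subset0.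
  by have := m1E A; rewrite m1K A0 !E finset.setD0 m0 !mulr1.
(* Both solutions satisfy the recursion at [A]; their terms at proper subsets agree by induction,
   which leaves the terms [S = A]. *)
have := m1E A; rewrite m1K !(bigD1 A (fintype.subxx _)) /= finset.setDv m0 !mulr1.
set X := \sum_(i | _) _; set Y := \sum_(i | _) _.
suff -> : X = Y by move/addIr.
apply: eq_bigr => S /andP[SA SnA]; rewrite IH // -ltnS.
by apply: leq_trans An; rewrite proper_card // finset.properEneq SnA SA.
Qed.

(** * Independence *)

(** Independence says that the joint law of [(U, V)] agrees with the product of the two laws on
    rectangles, hence everywhere; Fubini's theorem then factors the integral. *)
Lemma independent_mul d (T : measurableType d) (R : realType)
    (P : probability T R) (U V : {mfun T >-> R}) :
  (forall A B, measurable A -> measurable B ->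
    P (U @^-1` A `&` V @^-1` B) = (P (U @^-1` A) * P (V @^-1` B))%E) ->
  (U : T -> R) \in Lfun P 1 -> (V : T -> R) \in Lfun P 1 ->
  (fun w => U w * V w) \in Lfun P 1 /\
  Ex P (fun w => U w * V w) = Ex P U * Ex P V.
Proof.
move=> UV /Lfun1_integrable iU /Lfun1_integrable iV.
have mW : measurable_fun [set: T] (fun w => (U w, V w)) by exact: measurable_fun_pair.
pose W : {mfun T >-> (R * R)%type} :=
  HB.pack (fun w => (U w, V w)) (isMeasurableFun.Build _ _ _ _ _ mW).
pose PU := distribution P U; pose PV := distribution P V.
have PW A : measurable A -> A `<=` setT -> (PU \x PV)%E A = distribution P W A.
  move=> mA _; apply: product_measure_unique; last exact: mA.
  move=> B C mB mC.
  have := UV B C mB mC.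
  by rewrite /PU /PV /distribution /pushforward /= => <-; congr (P _).
pose f (z : R * R) : \bar R := (z.1 * z.2)%:E.
have mf : measurable_fun [set: R * R] f.
  by apply/measurable_EFinP; exact: measurable_funM.
have iU' : (PU).-integrable setT (EFin \o id).
  by apply: integrable_pushforward => //; apply/measurable_EFinP.
have iV' : (PV).-integrable setT (EFin \o id).
  by apply: integrable_pushforward => //; apply/measurable_EFinP.
(* By Tonelli, the integral of the absolute value is the product of two finite absolute moments. *)
have iUV : (PU \x PV)%E.-integrable setT f.
  apply/integrable12ltyP => //=.
  have mn : measurable_fun [set: R] (fun x : R => (`|x|%:E : \bar R)).
    by apply/measurable_EFinP; exact: normr_measurable.
  under eq_integral => x _.
    under eq_integral => y _ do rewrite /f /= normrM EFinM.
    rewrite ge0_integralZl //=.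
    over.
  move/integrableP : iU' => [_ iU']; move/integrableP : iV' => [_ iV'].
  rewrite ge0_integralZr //=; last by apply: integral_ge0.
  apply: lte_mul_pinfty => //; last by rewrite ge0_fin_numE ?integral_ge0.
  exact: integral_ge0.
have iW : (distribution P W).-integrable setT f.
  move/integrableP : iUV => [_ iUV]; apply/integrableP; split=> //.
  by rewrite -(eq_measure_integral _ PW).
have iUVT : P.-integrable setT (EFin \o (fun w => U w * V w)).
  move/integrableP : iW => [_ iW]; apply/integrableP; split.
    by apply/measurable_EFinP; exact: measurable_funM.
  rewrite ge0_integral_distribution // in iW.
  exact: measurableT_comp.
split; first exact/Lfun1_integrable.
rewrite /Ex unlock.
have -> : (\int[P]_w (U w * V w)%:E = \int[distribution P W]_z f z)%E.
  by rewrite integral_distribution.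
rewrite -(eq_measure_integral _ PW) -integral12_prod_meas1 // /fubini_F /=.
under eq_integral => x _.
  under eq_integral => y _ do rewrite /f /= EFinM.
  rewrite integralZl //=.
  over.
have fV : (\int[PV]_y y%:E)%E \is a fin_num by exact: integrable_fin_num.
have fU : (\int[PU]_y y%:E)%E \is a fin_num by exact: integrable_fin_num.
rewrite -(fineK fV) integralZr // fineM //; congr (_ * _).
  by rewrite integral_distribution //; apply/measurable_EFinP.
by rewrite /= integral_distribution //; apply/measurable_EFinP.
Qed.

Lemma measurable_prod_cond d (T : measurableType d) (R : realType) (D : set T)
    (I : eqType) (s : seq I) (Q : pred I) (h : I -> T -> R) :
  (forall i, Q i -> measurable_fun D (h i)) ->
  measurable_fun D (fun x => \prod_(i <- s | Q i) h i x).
Proof.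
move=> mh; under eq_fun do rewrite -big_filter.
by apply: measurable_prod => i; rewrite mem_filter => /andP[/mh].
Qed.

(** For fixed [E], both sides are finite measures in [A]; they agree on a family stable under
    intersection and containing the whole space, hence on the sigma-algebra that it generates. *)
Lemma independent_pi_lambda d (T : measurableType d) (R : realType)
    (P : probability T R) (G : set (set T)) (E : set T) :
  G `<=` measurable -> setI_closed G -> G setT -> measurable E ->
  (forall A, G A -> P (E `&` A) = (P E * P A)%E) ->
  forall A, <<s G >> A -> P (E `&` A) = (P E * P A)%E.
Proof.
move=> Gm GI GT mE GE A sA.
have fE : P E = (fine (P E))%:E by rewrite fineK // fin_num_measure.
have E0 : 0 <= fine (P E) by rewrite fine_ge0.
pose r : {nonneg R} := NngNum E0.
have H B : G B -> mrestr P mE B = mscale r P B.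
  by move=> GB; rewrite /mrestr /mscale /= setIC GE // -fE.
have : mrestr P mE A = mscale r P A.
  apply: (g_sigma_algebra_measure_unique G Gm (fun=> setT)) => //.
    by apply/seteqP; split=> // t _; exists 0%N.
  move=> _; change (P (setT `&` E) < +oo)%E.
  by rewrite setTI; apply: le_lt_trans (ltry 1); exact: probability_le1.
by rewrite /mrestr /mscale [(r%:num)%:E]/= -fE setIC.
Qed.

(** A generating family, stable under intersection, of the sigma-algebra of the variables [X i], [i]
    in [J]. *)
Definition rectangles d (T : measurableType d) (R : realType)
    (I : finType) (X : I -> T -> R) (J : {set I}) : set (set T) :=
  [set \bigcap_(i in [set` J]) X i @^-1` B i | B in
     [set B : I -> set R | forall i, measurable (B i)]].

Lemma setI_closed_rectangles d (T : measurableType d) (R : realType)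
    (I : finType) (X : I -> T -> R) (J : {set I}) : setI_closed (rectangles X J).
Proof.
move=> _ _ [B mB <-] [C mC <-]; exists (fun i => B i `&` C i).
  by move=> i; apply: measurableI.
by rewrite bigcapI.
Qed.

Lemma measurable_rectangles d (T : measurableType d) (R : realType)
    (I : finType) (X : I -> {mfun T >-> R}) (J : {set I}) :
  rectangles X J `<=` measurable.
Proof.
move=> _ [B mB <-]; apply: fin_bigcap_measurable => // i _.
exact: measurable_funPTI.
Qed.

Lemma measurable_fun_rectangles d (T : measurableType d) (R : realType)
    (I : finType) (X : I -> T -> R) (J : {set I}) (i : I) : i \in J ->
  measurable_fun (U := R) [set: g_sigma_algebraType (rectangles X J)] (X i).
Proof.
move=> iJ _ B mB; rewrite setTI; apply: sub_sigma_algebra.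
exists (fun j => if j == i then B else setT).
  by move=> j; case: ifP.
apply/seteqP; split=> [t /(_ i iJ)|t Xt j _] /=; first by rewrite eqxx.
by case: eqP => [->|].
Qed.

Lemma independent_rectangles d (T : measurableType d) (R : realType)
    (P : probability T R) (I : finType) (X : I -> {RV P >-> R}) (J : {set I})
    (k : I) (A : set R) (B : set T) : mutually_independent P X ->
  k \notin J -> measurable A -> <<s rectangles X J >> B ->
  P (X k @^-1` A `&` B) = (P (X k @^-1` A) * P B)%E.
Proof.
move=> XI kJ mA; apply: independent_pi_lambda.
- exact: measurable_rectangles.
- exact: setI_closed_rectangles.
- by exists (fun=> setT) => //; apply/seteqP.
- exact: measurable_funPTI.
move=> _ [C mC <-].
(* Gluing [A] at [k] to the sides [C] makes one rectangle over [k |: J], to which mutual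
   independence applies. *)
pose D i := if i == k then A else C i.
have DC i : i \in J -> D i = C i.
  by rewrite /D; case: eqP => // -> kJ'; rewrite kJ' in kJ.
have Dk : D k = A by rewrite /D eqxx.
have mD i : measurable (D i) by rewrite /D; case: ifP.
have := XI (k |: J)%SET D (fun i _ => mD i).
rewrite big_setU1 //= Dk.
have -> : (\prod_(i in J) P (X i @^-1` D i) = \prod_(i in J) P (X i @^-1` C i))%E.
  by apply: eq_bigr => i /DC ->.
rewrite -(XI J C (fun i _ => mC i)) => <-; congr (P _).
apply/seteqP; split=> t /=.
  move=> [At Ct] i /=; rewrite !inE => /orP[/eqP ->|iJ]; first by rewrite Dk.
  by rewrite DC //; apply: Ct.
move=> H; split; first by have := H k; rewrite /= !inE eqxx Dk; apply.
by move=> i iJ; have := H i; rewrite /= !inE iJ orbT DC //; apply.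
Qed.

Lemma Lfun1_cst d (T : measurableType d) (R : realType)
    (P : probability T R) (c : R) : (fun=> c) \in Lfun P 1.
Proof. exact/Lfun1_integrable/finite_measure_integrable_cst. Qed.

(** Induction on [J]: a factor [k] is split off, and it is independent of the product of the
    others. *)
Lemma expectation_prod d (T : measurableType d) (R : realType)
    (P : probability T R) (I : finType) (X : I -> {RV P >-> R})
    (h : I -> {mfun R >-> R}) (J : {set I}) : mutually_independent P X ->
  (forall i, (fun w => h i (X i w)) \in Lfun P 1) ->
  (fun w => \prod_(i in J) h i (X i w)) \in Lfun P 1 /\
  Ex P (fun w => \prod_(i in J) h i (X i w))
  = \prod_(i in J) Ex P (fun w => h i (X i w)).
Proof.
move=> XI hX; move: {2}#|J| (erefl #|J|) => n.
elim: n J => [|n IH] J.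
  move=> /eqP; rewrite finset.cards_eq0 => /eqP ->.
  under eq_fun do rewrite big_set0.
  by rewrite big_set0 /Ex expectation_cst; split=> //; apply: Lfun1_cst.
move=> Jn; have /finset.set0Pn[k kJ] : J != finset.set0.
  by rewrite -finset.cards_eq0 Jn.
have Jn' : #|J :\ k| = n by move: Jn; rewrite (cardsD1 k J) kJ => -[].
have kJ' : k \notin (J :\ k)%SET by rewrite !inE eqxx.
have [IH1 IH2] := IH _ Jn'.
under eq_fun do rewrite (big_setD1 k) //=.
rewrite (big_setD1 k) //= -IH2.
have mU : measurable_fun [set: T] (fun w => h k (X k w)) by exact: measurableT_comp.
have mV : measurable_fun [set: T] (fun w => \prod_(i in (J :\ k)%SET) h i (X i w)).
  by apply: measurable_prod_cond => i _; exact: measurableT_comp.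
pose U : {mfun T >-> R} := HB.pack (fun w => h k (X k w))
  (isMeasurableFun.Build _ _ _ _ _ mU).
pose V : {mfun T >-> R} := HB.pack (fun w => \prod_(i in (J :\ k)%SET) h i (X i w))
  (isMeasurableFun.Build _ _ _ _ _ mV).
apply: (@independent_mul _ _ _ P U V _ (hX k) IH1) => A B mA mB.
have : (measurable : set (set R)) (h k @^-1` A).
  exact: measurable_funPTI.
move=> mhA; apply: (independent_rectangles XI kJ' mhA).
(* The remaining product is measurable for the sigma-algebra of the variables other than [X k]. *)
have : measurable_fun (U := R) [set: g_sigma_algebraType (rectangles X (J :\ k)%SET)] V.
  apply: measurable_prod_cond => i iJ; apply: measurableT_comp => //.
  exact: measurable_fun_rectangles.
by move=> /(_ measurableT B mB); rewrite setTI.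
Qed.

Lemma expectation_prod_Z d d' (T : measurableType d) (T' : measurableType d')
    (R : realType) (P : probability T R) (I : finType) (X : I -> {RV P >-> R})
    (Z : {RV P >-> T'}) (h : I -> {mfun R >-> R}) (g : {mfun T' >-> R}) :
  mutually_independent P X ->
  independent_systems P (sigma_family X) (sigma_rv Z) ->
  (forall i, (fun w => h i (X i w)) \in Lfun P 1) ->
  (fun w => g (Z w)) \in Lfun P 1 ->
  (fun w => g (Z w) * \prod_i h i (X i w)) \in Lfun P 1 /\
  Ex P (fun w => g (Z w) * \prod_i h i (X i w))
  = Ex P (fun w => g (Z w)) * \prod_i Ex P (fun w => h i (X i w)).
Proof.
move=> XI XZ hX gZ.
have setTE (F : I -> R) : \prod_(i in [set: I]%SET) F i = \prod_i F i.
  by apply: eq_bigl => i; rewrite inE.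
have [] := expectation_prod [set: I]%SET XI hX.
rewrite setTE.
rewrite (_ : (fun w => \prod_(i in _) _) = (fun w => \prod_i h i (X i w))); last first.
  by apply/funext => w; rewrite setTE.
move=> p1 p2; rewrite -p2.
have mU : measurable_fun [set: T] (fun w => g (Z w)) by exact: measurableT_comp.
have mV : measurable_fun [set: T] (fun w => \prod_i h i (X i w)).
  by apply: measurable_prod_cond => i _; exact: measurableT_comp.
pose U : {mfun T >-> R} := HB.pack (fun w => g (Z w))
  (isMeasurableFun.Build _ _ _ _ _ mU).
pose V : {mfun T >-> R} := HB.pack (fun w => \prod_i h i (X i w))
  (isMeasurableFun.Build _ _ _ _ _ mV).
apply: (@independent_mul _ _ _ P U V _ gZ p1) => A B mA mB.
rewrite setIC muleC; apply: XZ.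
  have : measurable_fun (U := R)
      [set: g_sigma_algebraType (\bigcup_i sigma_rv (X i))] V.
    apply: measurable_prod_cond => i iJ; apply: measurableT_comp => //.
    move=> _ C mC; apply: sub_sigma_algebra; exists i => //.
    by exists C.
  by move=> /(_ measurableT B mB); rewrite setTI.
exists (g @^-1` A); last by rewrite setTI.
exact: measurable_funPTI.
Qed.

(** * Gaussian moments *)

(** Change of variables gives the Radon-Nikodym derivative as a density; it equals [normal_pdf]
    almost everywhere, having the same integral over every measurable set. *)
Lemma ge0_integral_normal_prob (R : realType) (m s : R) (f : R -> \bar R) :
  measurable_fun [set: R] f -> (forall x, (0 <= f x)%E) ->
  (\int[normal_prob m s]_x f x
   = \int[lebesgue_measure]_x (f x * (normal_pdf m s x)%:E))%E.
Proof.
move=> mf f0.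
have dom := normal_prob_dominates m s.
rewrite -(Radon_Nikodym_SigmaFinite.change_of_variables dom) //=.
have iF := Radon_Nikodym_SigmaFinite.f_integrable dom.
have mpdf : measurable_fun [set: R] (fun x => (normal_pdf m s x)%:E : \bar R).
  by apply/measurable_EFinP; exact: measurable_normal_pdf.
apply: ae_eq_integral => //.
- by apply: emeasurable_funM => //; exact: measurable_int iF.
- exact: emeasurable_funM.
apply: ae_eqe_mul2l; apply: integral_ae_eq => //= A _ mA.
by rewrite -Radon_Nikodym_SigmaFinite.f_integral.
Qed.

Lemma normal_prob_integrable (R : realType) (m s : R) (f : R -> R) :
  measurable_fun [set: R] f ->
  (lebesgue_measure).-integrable [set: R] (fun x => (f x * normal_pdf m s x)%:E) ->
  (normal_prob m s).-integrable [set: R] (EFin \o f).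
Proof.
move=> mf /integrableP[_ ifoo]; apply/integrableP; split.
  exact/measurable_EFinP.
rewrite ge0_integral_normal_prob //; last first.
  by apply: measurableT_comp => //; exact/measurable_EFinP.
under eq_integral => x _.
  rewrite /= -EFinM -[X in `|f x| * X]ger0_norm ?normal_pdf_ge0 // -normrM.
  over.
exact: ifoo.
Qed.

Lemma integral_normal_prob (R : realType) (m s : R) (f : R -> R) :
  measurable_fun [set: R] f ->
  (lebesgue_measure).-integrable [set: R] (fun x => (f x * normal_pdf m s x)%:E) ->
  (\int[normal_prob m s]_x (f x)%:E
   = \int[lebesgue_measure]_x (f x * normal_pdf m s x)%:E)%E.
Proof.
move=> mf ifp.
rewrite integralE [RHS]integralE.
have mf' : measurable_fun [set: R] (EFin \o f) by exact/measurable_EFinP.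
rewrite !ge0_integral_normal_prob //;
  [|exact: measurable_funeneg|exact: measurable_funepos].
have mulp (a : R) x : (maxe a%:E 0 * (normal_pdf m s x)%:E
    = maxe (a * normal_pdf m s x)%:E 0)%E.
  by rewrite -!EFin_max -EFinM maxr_pMl ?normal_pdf_ge0 // mul0r.
congr (_ - _)%E; apply: eq_integral => x _; first by rewrite !funeposE mulp.
by rewrite !funenegE /= mulp mulNr.
Qed.

Lemma exprn_le_expR (R : realType) (y : R) (n : nat) :
  0 <= y -> y ^+ n <= n`!%:R * expR y.
Proof.
move=> y0; case: n => [|n]; first by rewrite expr0 fact0 mul1r -expR0 ler_expR.
have /= := expR_ge1Dxn n y0.
rewrite -ler_pdivrMl ?ltr0n ?fact_gt0 // mulrC => h.
by apply: le_trans h; rewrite lerDr.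
Qed.

(** With [y = x^2 / (4 s^2)] the density at [s] is a multiple of [exp(-y) exp(-y)]. One factor
    absorbs the power of [x], the other is the density at [s * Num.sqrt 2] up to its peak. *)
Lemma normal_pdf_decay (R : realType) (s : R) (m : nat) : s != 0 ->
  exists2 C, 0 <= C & forall x,
    `|x| ^+ m * normal_pdf 0 s x <= C * normal_pdf 0 (s * Num.sqrt 2) x.
Proof.
move=> s0; have r0 : Num.sqrt 2 != 0 :> R by rewrite gt_eqF // sqrtr_gt0.
have s20 : s * Num.sqrt 2 != 0 by rewrite mulf_neq0.
have pk := normal_peak_gt0 s20.
(* From [|x|^m <= 1 + |x|^(2m) = 1 + (4 s^2)^m y^m] and [y^m <= m! exp(y)]. *)
pose K : R := 1 + (s ^+ 2 *+ 4) ^+ m * m`!%:R.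
have K0 : 0 <= K by rewrite addr_ge0 // mulr_ge0 // exprn_ge0 // mulrn_wge0 // sqr_ge0.
exists (normal_peak s * K / normal_peak (s * Num.sqrt 2)) => [|x].
  by rewrite divr_ge0 ?mulr_ge0 ?normal_peak_ge0.
rewrite !normal_pdfE // [leRHS]mulrA divfK ?gt_eqF // [leLHS]mulrCA -[leRHS]mulrA.
rewrite ler_wpM2l ?normal_peak_ge0 //.
rewrite /normal_fun subr0 exprMn sqr_sqrtr //.
pose y := x ^+ 2 / (s ^+ 2 *+ 4).
have y0 : 0 <= y by rewrite divr_ge0 ?sqr_ge0 // mulrn_wge0 // sqr_ge0.
have E1 : - x ^+ 2 / (s ^+ 2 *+ 2) = - y + - y by rewrite /y; field.
have E2 : - x ^+ 2 / (s ^+ 2 * 2 *+ 2) = - y by rewrite /y; field.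
rewrite E1 E2 expRD mulrA ler_wpM2r ?expR_ge0 //.
have xy : `|x| ^+ m <= 1 + (s ^+ 2 *+ 4) ^+ m * y ^+ m.
  rewrite -exprMn /y mulrC divfK; last first.
    by rewrite -mulr_natr mulf_neq0 // sqrf_eq0.
  rewrite -real_normK ?num_real // -exprM mulnC exprM.
  by have := sqr_ge0 (`|x| ^+ m - 1); nra.
rewrite expRN ler_pdivrMr ?expR_gt0 //; apply: le_trans xy _.
rewrite /K mulrDl mul1r; apply: lerD; first by rewrite -expR0 ler_expR.
by rewrite -mulrA ler_wpM2l ?exprn_le_expR // exprn_ge0 // mulrn_wge0 // sqr_ge0.
Qed.

Lemma integrable_exprn_normal_pdf (R : realType) (s : R) (m : nat) : s != 0 ->
  (lebesgue_measure).-integrable [set: R] (fun x => (x ^+ m * normal_pdf 0 s x)%:E).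
Proof.
move=> s0; have [C C0 HC] := normal_pdf_decay m s0.
have ig : (lebesgue_measure).-integrable [set: R]
    (fun x => (C * normal_pdf 0 (s * Num.sqrt 2) x)%:E).
  under eq_fun do rewrite EFinM.
  by apply: integrableZl => //; exact: integrable_normal_pdf.
apply: (le_integrable measurableT _ _ ig).
  apply/measurable_EFinP; apply: measurable_funM; last exact: measurable_normal_pdf.
  exact: measurable_funX.
move=> x _; rewrite /= lee_fin normrM normrX (ger0_norm (normal_pdf_ge0 _ _ _)).
by apply: le_trans (HC x) _; rewrite ler_norm.
Qed.

Lemma is_derive_normal_pdf (R : realType) (s x : R) : s != 0 ->
  is_derive x 1 (normal_pdf 0 s) (- (x / s ^+ 2) * normal_pdf 0 s x).
Proof.
move=> s0.
have E : normal_pdf 0 s = (fun x => normal_peak s * expR (- (s ^+ 2 *+ 2)^-1 * x ^+ 2)).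
  apply/funext => y; rewrite normal_pdfE // /normal_fun subr0.
  by congr (_ * expR _); rewrite mulrC mulrN mulNr.
rewrite E; apply: is_derive_eq.
rewrite /GRing.scale /=; field.
by [].
Qed.

(** The integrand is the derivative of [x^m] times the density, which vanishes at both infinities.
    This is Gaussian integration by parts; at [m = 0] the factor [m%:R] kills the term with
    [m.-1]. *)
Lemma integral_derive_normal (R : realType) (s : R) (m : nat) : s != 0 ->
  (\int[lebesgue_measure]_(x in [set: R])
    ((m%:R * x ^+ m.-1 - x ^+ m.+1 / s ^+ 2) * normal_pdf 0 s x)%:E = 0)%E.
Proof.
move=> s0.
pose F (x : R) := x ^+ m * normal_pdf 0 s x.
pose f (x : R) := (m%:R * x ^+ m.-1 - x ^+ m.+1 / s ^+ 2) * normal_pdf 0 s x.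
have dF (x : R) : is_derive x 1 F (f x).
  have := is_derive_normal_pdf x s0 => dpdf.
  have -> : F = id ^+ m * normal_pdf 0 s by apply/funext => y; rewrite /F exprfctE.
  apply: is_derive_eq.
  by rewrite exprfctE /f /GRing.scale /= [x ^+ m.+1]exprS; field.
have cf : continuous f.
  move=> x; apply: cvgM; last exact: continuous_normal_pdf.
  apply: cvgB; first by apply: cvgM; [exact: cvg_cst|exact: exprn_continuous].
  by apply: cvgM; [exact: exprn_continuous|exact: cvg_cst].
have intf : (lebesgue_measure).-integrable [set: R] (EFin \o f).
  have i1 := integrable_exprn_normal_pdf m.-1 s0.
  have i2 := integrable_exprn_normal_pdf m.+1 s0.
  have -> : EFin \o f = (fun x => m%:R%:E * (x ^+ m.-1 * normal_pdf 0 s x)%:E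
      - (s ^+ 2)^-1%:E * (x ^+ m.+1 * normal_pdf 0 s x)%:E)%E.
    apply/funext => x; rewrite -!EFinM -EFinB /= /f; congr EFin.
    by rewrite mulrBl; congr (_ - _); ring.
  by apply: integrableB => //; apply: integrableZl.
have [C C0 HC] := normal_pdf_decay m.+1 s0.
pose D := C * normal_peak (s * Num.sqrt 2).
(* One power more than in [F] is bounded by [D], so the boundary terms decay like [1 / |x|]. *)
have FD (n : nat) : `|F n.+1%:R - F (- n.+1%:R)| <= (D *+ 2) / n.+1%:R.
  have B x : `|x| = n.+1%:R -> `|F x| <= D / n.+1%:R.
    move=> xn; rewrite /F normrM normrX (ger0_norm (normal_pdf_ge0 _ _ _)) xn.
    rewrite ler_pdivlMr ?ltr0n // mulrAC -exprSr -xn.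
    apply: le_trans (HC x) _; apply: ler_wpM2l => //; apply: normal_pdf_ub.
    by rewrite mulf_neq0 // gt_eqF // sqrtr_gt0.
  apply: le_trans (ler_normB _ _) _; rewrite mulr2n mulrDl.
  by apply: lerD; apply: B; rewrite ?normrN ger0_norm.
pose I n : set R := `[- n.+1%:R, n.+1%:R]%classic.
have intI (n : nat) :
    (\int[lebesgue_measure]_(x in I n) (f x)%:E = (F n.+1%:R - F (- n.+1%:R))%:E)%E.
  rewrite (@continuous_FTC2 _ f F) ?EFinB //.
  - by apply: (@lt_trans _ _ 0); rewrite ?oppr_lt0 ltr0n.
  - by apply: continuous_subspaceT.
  - have cF (x : R) : {for x, continuous F}.
      by apply/differentiable_continuous/derivable1_diffP; apply: ex_derive.
    split=> [x _||]; first exact: ex_derive.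
      exact/cvg_at_right_filter/cF.
    exact/cvg_at_left_filter/cF.
  - by move=> x _; rewrite derive1E; apply: derive_val.
(* The integrals over the growing intervals tend to the full integral by domination by [|f|], and to
   0 by [FD]. *)
have mf : measurable_fun [set: R] (EFin \o f) by exact: measurable_int intf.
have [|||||_ _] := @dominated_convergence _ _ _ lebesgue_measure [set: R] measurableT
  (fun n => (EFin \o f) \_ (I n)) (EFin \o f) (abse \o (EFin \o f)).
- move=> n; apply/(measurable_restrictT _ _).1; first exact: measurable_itv.
  exact: measurable_funTS.
- exact: mf.
- apply: aeW => x _; apply: cvg_near_cst.
  near=> n; rewrite patchE mem_set // /I /= in_itv /= -ler_norml.
  apply: (@le_trans _ _ n%:R); last by rewrite ler_nat.
  by near: n; exact: nbhs_infty_ger.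
- exact: integrable_abse.
- apply: aeW => x n _; rewrite /= patchE; case: ifP => // _.
  by rewrite abse0 lee_fin.
under eq_fun do rewrite -integral_mkcond intI.
have cvF : (F n.+1%:R - F (- n.+1%:R)) @[n --> \oo] --> (0 : R).
  apply/norm_cvg0P.
  have B : \forall n \near \oo,
      0 <= `|F n.+1%:R - F (- n.+1%:R)| <= (D *+ 2) * harmonic n.
    by apply: nearW => n; rewrite normr_ge0 FD.
  apply: (squeeze_cvgr B); first exact: cvg_cst.
  rewrite -[X in _ --> X](mulr0 (D *+ 2)); apply: cvgM; first exact: cvg_cst.
  exact: cvg_harmonic.
have cv0 : ((F n.+1%:R - F (- n.+1%:R))%:E @[n --> \oo] --> (0 : \bar R))%E.
  by apply: cvg_EFin => //; exact: nearW.
by move=> cv; exact: (cvg_unique _ cv cv0).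
Unshelve. all: by end_near. Qed.

(** Once transported to the law of [X], the recursion is [integral_derive_normal] solved for the
    higher moment. *)
Lemma normal_moments d (T : measurableType d) (R : realType)
    (P : probability T R) (s : R) (X : {RV P >-> R}) : s != 0 ->
  (forall A : set R, measurable A -> distribution P X A = normal_prob 0 s A) ->
  (forall m, (fun w => X w ^+ m) \in Lfun P 1) /\
  (forall m, Ex P (fun w => X w ^+ m.+1)
             = s ^+ 2 * (m%:R * Ex P (fun w => X w ^+ m.-1))).
Proof.
move=> s0 XN.
(* Lebesgue measure and [normal_prob] live on [measurableTypeR R], whose
   display differs from the one of [R]. *)
have mX' : measurable_fun [set: T] (X : T -> measurableTypeR R).
  by move=> mT B mB; rewrite setTI; exact: (@measurable_funPTI _ _ _ _ X B mB).
pose X' : {mfun T >-> measurableTypeR R} :=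
  HB.pack (X : T -> measurableTypeR R) (isMeasurableFun.Build _ _ _ _ _ mX').
have X'N (A : set (measurableTypeR R)) : measurable A -> A `<=` setT ->
  distribution P X' A = normal_prob 0 s A by move=> mA _; exact: XN.
have mX m : measurable_fun [set: measurableTypeR R] (fun x : R => x ^+ m).
  exact: measurable_funX.
have mXE m :
    measurable_fun [set: measurableTypeR R] (fun x : R => (x ^+ m)%:E : \bar R).
  exact/measurable_EFinP.
have iN m : (normal_prob 0 s).-integrable [set: R] (EFin \o (fun x : R => x ^+ m)).
  by apply: normal_prob_integrable => //; exact: integrable_exprn_normal_pdf.
have iP m : P.-integrable setT (EFin \o (fun w => X w ^+ m)).
  apply/integrableP; split; first by apply/measurable_EFinP; exact: measurable_funX.
  have -> : (\int[P]_w `|(X w ^+ m)%R%:E|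
      = \int[distribution P X']_x `|(x ^+ m)%R%:E|)%E.
    by rewrite ge0_integral_distribution //; exact: measurableT_comp.
  rewrite (eq_measure_integral _ X'N).
  by have /integrableP[] := iN m.
have fin m : (\int[normal_prob 0 s]_x (x ^+ m)%R%:E)%E \is a fin_num.
  exact: integrable_fin_num (iN m).
have ExE m : Ex P (fun w => X w ^+ m)
    = fine (\int[lebesgue_measure]_x (x ^+ m * normal_pdf 0 s x)%:E)%E.
  rewrite /Ex unlock -integral_normal_prob //; last exact: integrable_exprn_normal_pdf.
  congr fine; rewrite -(eq_measure_integral _ X'N).
  by rewrite (@integral_distribution _ _ _ _ _ P X' _ (mXE m) (iP m)).
split=> m; first exact/Lfun1_integrable.
rewrite !ExE.
have i1 := integrable_exprn_normal_pdf m.-1 s0.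
have i2 := integrable_exprn_normal_pdf m.+1 s0.
have := integral_derive_normal m s0.
have E x : (((m%:R * x ^+ m.-1 - x ^+ m.+1 / s ^+ 2) * normal_pdf 0 s x)%:E
    = m%:R%:E * (x ^+ m.-1 * normal_pdf 0 s x)%:E
      - (s ^+ 2)^-1%:E * (x ^+ m.+1 * normal_pdf 0 s x)%:E)%E.
  by rewrite -!EFinM -EFinB; congr EFin; rewrite mulrBl; congr (_ - _); ring.
under eq_integral do rewrite E.
rewrite integralB //; [|by apply: integrableZl|by apply: integrableZl].
rewrite !integralZl // -(fineK (integrable_fin_num measurableT i1)).
rewrite -(fineK (integrable_fin_num measurableT i2)) -!EFinM -EFinB => -[] /eqP.
rewrite subr_eq0 => /eqP ->.
by rewrite mulVKf // sqrf_eq0.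
Qed.

(** * The Wick formula *)

Lemma Lfun1_le d (T : measurableType d) (R : realType) (P : probability T R)
    (f g : T -> R) : measurable_fun [set: T] g -> (forall w, `|g w| <= `|f w|) ->
  f \in Lfun P 1 -> g \in Lfun P 1.
Proof.
move=> mg gf /Lfun1_integrable fi; apply/Lfun1_integrable.
apply: (le_integrable measurableT _ _ fi); first exact/measurable_EFinP.
by move=> w _; rewrite /= lee_fin.
Qed.

Lemma Ex_mulr d (T : measurableType d) (R : realType) (P : probability T R)
    (f : T -> R) (c : R) : f \in Lfun P 1 ->
  Ex P (fun w => f w * c) = Ex P f * c.
Proof.
move=> fL; rewrite /Ex (_ : (fun w => _) = (c \o* f)); last exact/funext.
by rewrite expectationZl // fineM // ?expectation_fin_num // mulrC.
Qed.

Lemma Ex_sum d (T : measurableType d) (R : realType) (P : probability T R)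
    (I : Type) (r : seq I) (F : I -> T -> R) : (forall i, F i \in Lfun P 1) ->
  (fun w => \sum_(i <- r) F i w) \in Lfun P 1 /\
  Ex P (fun w => \sum_(i <- r) F i w) = \sum_(i <- r) Ex P (F i).
Proof.
move=> FL; elim: r => [|i r [IH1 IH2]].
  under eq_fun do rewrite big_nil.
  by rewrite big_nil /Ex expectation_cst; split=> //; exact: Lfun1_cst.
have -> : (fun w => \sum_(j <- i :: r) F j w) = (F i \+ (fun w => \sum_(j <- r) F j w)).
  by apply/funext => w; rewrite big_cons.
split; first exact: rpredD.
by rewrite /Ex expectationD // fineD ?expectation_fin_num // big_cons -IH2.
Qed.

Lemma normr_prod_le1 (R : realDomainType) (I : Type) (r : seq I) (Q : pred I)
    (F : I -> R) : (forall i, `|F i| <= 1) -> `|\prod_(i <- r | Q i) F i| <= 1.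
Proof.
move=> F1; elim/big_ind: _ => [|a b a1 b1|//]; first by rewrite normr1.
by rewrite normrM mulr_ile1.
Qed.

(** Labels range over a finite set, so conditioning on them is a finite sum over label functions
    [t]. The factor [f] is general because both [x] and the constant 1 are needed, and
    [|D c z| <= 1] reduces integrability to that of [f]. *)
Lemma wick d d' (T : measurableType d) (Zt : measurableType d') (R : realType)
    (P : probability T R) (Z : {RV P >-> Zt}) (J U : finType)
    (nu : J -> {RV P >-> R}) (s : R) (D : U -> {mfun Zt >-> R})
    (th : U -> Zt -> J) (f : {mfun Zt >-> R}) (A : {set U}) :
  s != 0 ->
  (forall k (B : set R), measurable B -> distribution P (nu k) B = normal_prob 0 s B) ->
  mutually_independent P nu ->
  independent_systems P (sigma_family nu) (sigma_rv Z) ->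
  (forall c z, `|D c z| <= 1) ->
  (forall c k, measurable (th c @^-1` [set k])) ->
  (fun w => f (Z w)) \in Lfun P 1 ->
  Ex P (fun w => f (Z w) * \prod_(c in A) (D c (Z w) * nu (th c (Z w)) w))
  = s ^+ #|A| * \sum_(pi | pairing A pi) Ex P (fun w => f (Z w) *
      \prod_(B in pi) (\prod_(c in B) D c (Z w) *
                       (#|(th ^~ (Z w)) @: B| == 1%N)%:R)).
Proof.
move=> s0 nuN nuI nuZ D1 mth fL.
pose ind (t : {ffun U -> J}) z : R := \prod_c (th c z == t c)%:R.
pose g t z := f z * \prod_(c in A) D c z * ind t z.
have mind t : measurable_fun [set: Zt] (ind t).
  apply: measurable_prod_cond => c _.
  rewrite (_ : (fun z => _) = \1_(th c @^-1` [set t c])).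
    exact: measurable_indic.
  apply/funext => z; rewrite indicE; congr (nat_of_bool _)%:R.
  by apply/eqP/idP => [|/[!inE]//] ?; rewrite inE.
have mg t : measurable_fun [set: Zt] (g t).
  apply: measurable_funM => //; apply: measurable_funM => //.
  by apply: measurable_prod_cond => c _; exact: measurable_funP.
have gf t z : `|g t z| <= `|f z|.
  rewrite /g -mulrA normrM ler_piMr // normrM mulr_ile1 //.
    exact: normr_prod_le1.
  by apply: normr_prod_le1 => c; case: eqP; rewrite ?normr1 ?normr0.
have gL t : (fun w => g t (Z w)) \in Lfun P 1.
  apply: Lfun1_le fL; last by move=> w; exact: gf.
  exact: measurableT_comp.
(* Exactly one [t] has a nonzero indicator, so any function of the random labels expands over fixed
   label functions. *)
have sum_ind (h : {ffun U -> J} -> R) z :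
    h [ffun c => th c z] = \sum_t ind t z * h t.
  rewrite (bigD1 [ffun c => th c z]) //= big1 ?addr0.
    rewrite /ind big1 ?mul1r // => c _.
    by rewrite ffunE eqxx.
  move=> t tz; suff -> : ind t z = 0 by rewrite mul0r.
  apply/eqP; rewrite /ind prodf_seq_eq0; apply/hasP.
  have [c tc] : exists c, t c != th c z.
    apply/existsP; apply: contraNT tz; rewrite negb_exists => /forallP H.
    by apply/eqP/ffunP => c; rewrite ffunE; apply/eqP; have := H c; rewrite negbK.
  by exists c; rewrite ?mem_index_enum //= [th c z == _]eq_sym (negbTE tc).
pose M k m := Ex P (fun w => nu k w ^+ m).
have M0 k : M k 0%N = 1.
  by rewrite /M; under eq_fun do rewrite expr0; rewrite /Ex expectation_cst.
have MS k m : M k m.+1 = s ^+ 2 * (m%:R * M k m.-1).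
  by have [_] := normal_moments s0 (nuN k); apply.
have nuL k m : (fun w => nu k w ^+ m) \in Lfun P 1.
  by have [+ _] := normal_moments s0 (nuN k); apply.
pose mul (t : {ffun U -> J}) k := #|[set c in A | t c == k]%SET|.
(* For fixed labels the product of the [nu] is a monomial in independent variables, independent of
   [Z], and the expectation factors. *)
have key t : (fun w => g t (Z w) * \prod_(c in A) nu (t c) w) \in Lfun P 1 /\
    Ex P (fun w => g t (Z w) * \prod_(c in A) nu (t c) w)
    = Ex P (fun w => g t (Z w)) * \prod_k M k (mul t k).
  have mX k : measurable_fun [set: R] (fun x : R => x ^+ mul t k).
    exact: measurable_funX.
  pose h k : {mfun R >-> R} := HB.pack (fun x : R => x ^+ mul t k)
    (isMeasurableFun.Build _ _ _ _ _ (mX k)).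
  pose gm : {mfun Zt >-> R} := HB.pack (g t) (isMeasurableFun.Build _ _ _ _ _ (mg t)).
  have := @expectation_prod_Z _ _ _ _ _ P _ nu Z h gm nuI nuZ (fun k => nuL k _) (gL t).
  rewrite /=.
  rewrite (_ : (fun w => g t (Z w) * \prod_i nu i w ^+ mul t i)
    = (fun w => g t (Z w) * \prod_(c in A) nu (t c) w)) //.
  by apply/funext => w; rewrite (prod_comp_exp t A (fun k => nu k w)).
transitivity (\sum_(t : {ffun U -> J})
    Ex P (fun w => g t (Z w)) * \prod_k M k (mul t k)).
  rewrite (_ : (fun w => _) = (fun w => \sum_(t : {ffun U -> J}) g t (Z w) *
      \prod_(c in A) nu (t c) w)); last first.
    apply/funext => w; rewrite big_split /= mulrA.
    rewrite (_ : \prod_(c in A) nu _ w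
        = \prod_(c in A) nu ([ffun c => th c (Z w)] c) w).
      rewrite (sum_ind (fun t : {ffun U -> J} => \prod_(c in A) nu (t c) w)).
      by rewrite big_distrr /=; apply: eq_bigr => t _; rewrite /g !mulrA.
    by apply: eq_bigr => c _; rewrite ffunE.
  have [_ ->] := Ex_sum (index_enum _) (fun t => (key t).1).
  by apply: eq_bigr => t _; rewrite (key t).2.
under eq_bigr => t _ do rewrite /mul (isserlis _ _ M0 MS) mulrCA big_distrr /=.
rewrite -big_distrr /= exchange_big /=; congr (_ * _).
apply: eq_bigr => pi /pairingP[pA _].
pose e (t : {ffun U -> J}) : R := \prod_(B in pi) (#|t @: B| == 1%N)%:R.
have ge t : (fun w => g t (Z w) * e t) \in Lfun P 1.
  apply: Lfun1_le (gL t); first by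
    apply: measurable_funM => //; exact: measurableT_comp.
  move=> w; rewrite normrM ler_piMr // /e; apply: normr_prod_le1 => B.
  by case: (_ == _); rewrite ?normr1 ?normr0.
transitivity (Ex P (fun w => \sum_t g t (Z w) * e t)).
  have [_ ->] := Ex_sum (index_enum _) ge.
  by apply: eq_bigr => t _; rewrite Ex_mulr.
(* The expansion over [t] is now undone, with [e] in place of the product of the [nu]. *)
congr (Ex P _); apply/funext => w; rewrite big_split /= mulrA.
rewrite -(set_partition_big _ pA).
rewrite (_ : \prod_(B in pi) (#|_| == 1%N)%:R = e [ffun c => th c (Z w)]).
  by rewrite sum_ind big_distrr /=; apply: eq_bigr => t _; rewrite /g !mulrA.
apply: eq_bigr => B _.
have -> : ((th ^~ (Z w)) @: B = [ffun c => th c (Z w)] @: B)%SET.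
  by apply: eq_imset => c; rewrite ffunE.
by [].
Qed.

(** * Multisets of positions *)

Lemma msupp_beta_of (n p : nat) (alpha : 'M[nat]_(n, p))
    (B : {set copies alpha}) : msupp (beta_of B) = (tag @: B)%SET.
Proof.
apply/finset.setP => ij; rewrite inE mxE -surjective_pairing card_gt0.
apply/finset.set0Pn/finset.imsetP => [[c]|[c cB ->]].
  by rewrite inE => /andP[cB /eqP <-]; exists c.
by exists c; rewrite inE cB eqxx.
Qed.

Lemma card_tag_sum (n p : nat) (alpha : 'M[nat]_(n, p))
    (B : {set copies alpha}) (ij : 'I_n * 'I_p) :
  #|[set c in B | tag c == ij]%SET| = (\sum_(c in B) (tag c == ij))%N.
Proof.
rewrite -sum1_card big_mkcond [RHS]big_mkcond; apply: eq_bigr => c _.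
by rewrite !inE; case: (c \in B) => //=; case: (tag c == ij).
Qed.

Lemma msize_beta_of (n p : nat) (alpha : 'M[nat]_(n, p))
    (B : {set copies alpha}) : msize (beta_of B) = #|B|.
Proof.
rewrite /msize pair_big /=.
under eq_bigr => ij _ do rewrite mxE -surjective_pairing card_tag_sum.
rewrite exchange_big -sum1_card /=; apply: eq_bigr => c _.
by rewrite (bigD1 (tag c)) //= eqxx big1 // => ij; rewrite eq_sym => /negbTE ->.
Qed.

Lemma beta_of_setT (n p : nat) (alpha : 'M[nat]_(n, p)) :
  beta_of [set: copies alpha]%SET = alpha.
Proof.
apply/matrixP => i j; rewrite mxE.
pose F (k : 'I_(alpha i j)) : copies alpha :=
  @Tagged _ (i, j) (fun ij : 'I_n * 'I_p => 'I_(alpha ij.1 ij.2)) k.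
have FI : injective F by move=> k k' /eqP; rewrite eq_Tagged => /eqP.
rewrite -[RHS]card_ord -(card_imset _ FI); apply: eq_card => c.
rewrite !inE; apply/eqP/finset.imsetP => [|[k _ ->] //].
case: c => -[i' j'] k /= [ei ej]; subst i' j'.
by exists k.
Qed.

Lemma msize_copies (n p : nat) (alpha : 'M[nat]_(n, p)) :
  msize alpha = #|[set: copies alpha]%SET|.
Proof. by rewrite -msize_beta_of beta_of_setT. Qed.

Lemma sum_beta_of (n p : nat) (alpha : 'M[nat]_(n, p))
    (A : {set copies alpha}) (pi : {set {set copies alpha}}) :
  finset.partition pi A -> \sum_(B in pi) beta_of B = beta_of A.
Proof.
move=> pA; apply/matrixP => i j; rewrite summxE mxE card_tag_sum.
rewrite (set_partition_big _ pA) /=.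
by apply: eq_bigr => B _; rewrite mxE card_tag_sum.
Qed.

Lemma delta_pow_beta_of (Zt : Type) (R : realType) (n p : nat)
    (delta : 'I_n -> 'I_p -> Zt -> R) (alpha : 'M[nat]_(n, p))
    (B : {set copies alpha}) (z : Zt) :
  delta_pow delta (beta_of B) z = \prod_(c in B) delta (tag c).1 (tag c).2 z.
Proof.
rewrite (prod_comp_exp (fun c : copies alpha => tag c) B
  (fun ij : 'I_n * 'I_p => delta ij.1 ij.2 z)) /delta_pow pair_big /=.
by apply: eq_bigr => ij _; rewrite mxE -surjective_pairing.
Qed.

(** If some [delta] vanishes on [B], both sides are 0; otherwise the nonvanishing condition of
    [Omega] holds and its indicator reduces to the condition on the labels. *)
Lemma delta_pow_Omega (Zt : Type) (R : realType) (n p K L : nat)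
    (delta : 'I_n -> 'I_p -> Zt -> R) (theta : 'I_n -> 'I_p -> Zt -> 'I_K * 'I_L)
    (alpha : 'M[nat]_(n, p)) (B : {set copies alpha}) (z : Zt) :
  delta_pow delta (beta_of B) z * \1_(Omega delta theta (beta_of B)) z
  = \prod_(c in B) delta (tag c).1 (tag c).2 z *
    (#|(fun c : copies alpha => theta (tag c).1 (tag c).2 z) @: B| == 1%N)%:R.
Proof.
rewrite delta_pow_beta_of.
have [/exists_inP[c cB /eqP d0]|nz] :=
    boolP [exists c in B, delta (tag c).1 (tag c).2 z == 0].
  by rewrite (bigD1 c) //= d0 !mul0r.
congr (_ * _); rewrite indicE; congr (nat_of_bool _)%:R.
have E : ((fun ij : 'I_n * 'I_p => theta ij.1 ij.2 z) @: msupp (beta_of B)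
    = (fun c : copies alpha => theta (tag c).1 (tag c).2 z) @: B)%SET.
  by rewrite msupp_beta_of -imset_comp.
apply/idP/eqP => [|E1]; first by rewrite inE -E => -[].
rewrite inE; split=> /=; last by rewrite E.
move=> ij; rewrite msupp_beta_of => /finset.imsetP[c cB ->].
by apply: contra nz => d0; apply/exists_inP; exists c.
Qed.

Lemma measurable_Omega d' (Zt : measurableType d') (R : realType)
    (n p K L : nat) (delta : 'I_n -> 'I_p -> {mfun Zt >-> R})
    (theta : 'I_n -> 'I_p -> Zt -> 'I_K * 'I_L) (beta : 'M[nat]_(n, p)) :
  (forall i j kl, measurable (theta i j @^-1` [set kl])) ->
  measurable (Omega delta theta beta).
Proof.
move=> mth; apply: measurableI.
  rewrite (_ : [set z | _]
    = \bigcap_(ij in [set` msupp beta]) (delta ij.1 ij.2 @^-1` [set~ 0])).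
    apply: fin_bigcap_measurable => // ij _.
    by apply: measurable_funPTI; exact: measurableC.
  by apply/seteqP; split=> z H ij hij; [apply/eqP|apply/eqP]; exact: H.
(* The label condition is a finite union, over the assignments [t] satisfying it, of the events that
   the labels equal [t]. *)
pose Q (t : {ffun 'I_n * 'I_p -> 'I_K * 'I_L}) := #|(t @: msupp beta)%SET| == 1%N.
rewrite (_ : [set z | _] = \bigcup_(t in [set t | Q t])
    \bigcap_(ij in [set: 'I_n * 'I_p]) (theta ij.1 ij.2 @^-1` [set t ij])).
  apply: fin_bigcup_measurable; first exact: finite_finset.
  by move=> t _; apply: fin_bigcap_measurable; first exact: finite_finset.
apply/seteqP; split=> z /=.
  move=> E; exists [ffun ij => theta ij.1 ij.2 z]; last first.
    by move=> ij _; rewrite /= ffunE.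
  rewrite /Q /= -E; apply/eqP; congr #|pred_of_set _|.
  by apply: eq_imset => ij; rewrite ffunE.
move=> [t /eqP <- tz]; congr #|pred_of_set _|.
by apply: eq_imset => ij; exact: tz.
Qed.

(** * Domination by indicators and the recursive bound *)

Lemma Ex_norm_le d (T : measurableType d) (R : realType) (P : probability T R)
    (f g : T -> R) : measurable_fun [set: T] f -> g \in Lfun P 1 ->
  (forall w, `|f w| <= g w) -> `|Ex P f| <= Ex P g.
Proof.
move=> mf gL fg.
have g0 w : 0 <= g w by apply: le_trans (fg w).
have fL : f \in Lfun P 1.
  by apply: Lfun1_le gL => // w; rewrite (ger0_norm (g0 w)).
have nfL : (fun w => `|f w|) \in Lfun P 1 by exact: Lfun_norm.
move/Lfun1_integrable in fL; move/Lfun1_integrable in nfL.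
move/Lfun1_integrable in gL.
rewrite /Ex unlock.
apply: (@le_trans _ _ (\int[P]_w `|f w|)).
  exact: (@le_normr_Rintegral _ _ _ P setT f measurableT fL).
exact: (@le_Rintegral _ _ _ P setT _ _ measurableT nfL gL).
Qed.

(** The hypothesis bounds every factor by 1 and makes it vanish off its own set, so the product
    vanishes off the intersection. *)
Lemma normr_prod_indic_le (T : Type) (R : realDomainType) (I : finType)
    (A : {set I}) (W : I -> T -> R) (O : I -> set T) (w : T) :
  (forall i, `|W i w| <= \1_(O i) w) ->
  `|\prod_(i in A) W i w| <= \1_(\bigcap_(i in [set` A]) O i) w.
Proof.
move=> WO; have [Ow|nO] := pselect ((\bigcap_(i in [set` A]) O i) w).
  rewrite [leRHS]indicE mem_set //; apply: normr_prod_le1 => i.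
  apply: le_trans (WO i) _.
  by rewrite indicE; case: (_ \in _).
rewrite [leRHS]indicE memNset //.
have [i [iA nOi]] : exists i, i \in A /\ ~ O i w.
  apply: contrapT => H; apply: nO => i /= iA; apply: contrapT => nOi.
  by apply: H; exists i.
rewrite (bigD1 i) //= (_ : W i w = 0) ?mul0r ?normr0 //.
by apply/eqP; rewrite -normr_le0; apply: le_trans (WO i) _; rewrite indicE memNset.
Qed.

Lemma Cum1_le d (T : measurableType d) (R : realType) (P : probability T R)
    (x : T -> R) (I : finType) (W : I -> T -> R) (O : I -> set T) :
  x \in Lfun P 1 -> (forall i, measurable (O i)) ->
  (forall i, measurable_fun [set: T] (W i)) ->
  (forall i w, `|W i w| <= \1_(O i) w) ->
  `|Cum1 P x [set: I]%SET W|
  <= Ex_on P (fun w => `|x w|) (\bigcap_i O i)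
     + \sum_(S : {set I} | S \proper [set: I]%SET)
         `|Cum1 P x S W| * fine (P (\bigcap_(i in [set i | i \notin S]) O i)).
Proof.
move=> xL mO mW WO.
have mx : measurable_fun [set: T] x.
  by move/Lfun1_integrable : xL => /measurable_int /measurable_EFinP.
have mcap (A : {set I}) : measurable (\bigcap_(i in [set` A]) O i).
  by apply: fin_bigcap_measurable.
have mprod (A : {set I}) : measurable_fun [set: T] (fun w => \prod_(i in A) W i w).
  by apply: measurable_prod_cond => i _; exact: mW.
(* In the recursion the term [S = [set: I]] has the empty moment 1 as its factor, so it can be
   isolated. *)
have H : Cum1 P x [set: I]%SET W = mom1 P x [set: I]%SET W
    - \sum_(S : {set I} | S \proper [set: I]%SET)
        Cum1 P x S W * mom P ([set: I] :\: S)%SET W.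
  rewrite mom1_Cum1 (bigD1 [set: I]%SET) ?fintype.subxx //= finset.setDv.
  rewrite mom_set0 mulr1.
  rewrite (eq_bigl (fun S : {set I} => S \proper [set: I]%SET)) ?addrK //.
  by move=> S; rewrite finset.properEneq andbC.
rewrite H; apply: le_trans (ler_normB _ _) _; apply: lerD.
  have /Lfun_norm xnL := xL.
  have capE : \bigcap_i O i = \bigcap_(i in [set` [set: I]%SET]) O i.
    by apply/seteqP; split=> w Ow i _; apply: Ow => //=; rewrite inE.
  rewrite /Ex_on capE; apply: Ex_norm_le.
  - exact: measurable_funM.
  - apply: Lfun1_le xnL => [|w].
      by apply: measurable_funM; [exact: measurableT_comp|exact: measurable_indic].
    rewrite normrM normr_id ler_piMr // indicE.
    by case: (_ \in _); rewrite ?normr1 ?normr0.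
  - move=> w; rewrite normrM ler_wpM2l //.
    exact: normr_prod_indic_le.
apply: le_trans (ler_norm_sum _ _ _) _; apply: ler_sum => S _.
rewrite normrM ler_wpM2l // (_ : \bigcap_(i in _) O i =
    \bigcap_(i in [set` ([set: I] :\: S)%SET]) O i); last first.
  by apply/seteqP; split=> w Ow i /= iS; apply: Ow; move: iS; rewrite /= !inE ?andbT.
rewrite -expectation_indic //; apply: Ex_norm_le => //.
  apply: Lfun1_le (Lfun1_cst P 1) => // w; rewrite indicE normr1.
  by case: (_ \in _); rewrite ?normr1 ?normr0.
by move=> w; exact: normr_prod_indic_le.
Qed.

(** * The cumulant formula, the pair multisets and the recursive bound *)

Theorem theorem2p5
    (d d' : measure_display) (T : measurableType d) (Zt : measurableType d')
    (R : realType) (P : probability T R)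
    (n p K L : nat)
    (Z : {RV P >-> Zt})
    (delta : 'I_n -> 'I_p -> {mfun Zt >-> R})
    (delta_val : forall i j z, delta i j z \in [:: 0; 1; -1])
    (theta : 'I_n -> 'I_p -> Zt -> 'I_K * 'I_L)
    (theta_meas : forall i j kl, measurable (theta i j @^-1` [set kl]))
    (lambda : R) (lambda_gt0 : 0 < lambda)
    (nu : 'I_K * 'I_L -> {RV P >-> R})
    (nu_normal : forall kl (A : set R), measurable A ->
       distribution P (nu kl) A = normal_prob 0 lambda A)
    (nu_indep : mutually_independent P nu)
    (nu_Z_indep : independent_systems P (sigma_family nu) (sigma_rv Z))
    (x : {mfun Zt >-> R})
    (x_L2 : (fun w => x (Z w)) \in Lfun P 2%:E)
    (l : nat) (alpha : 'M[nat]_(n, p))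
    (alpha_size : msize alpha = (2 * l)%N) :
  [/\ Cum1 P (fun w => x (Z w)) [set: copies alpha]%SET
        (fun c => signal Z delta theta nu (tag c).1 (tag c).2)
      = lambda ^+ msize alpha *
        \sum_(pi in pairings alpha) C_x P Z delta theta x (@beta_of n p alpha) pi,
      forall pi, pi \in pairings alpha ->
        [/\ #|pi| = l,
            forall B, B \in pi -> msize (beta_of B) = 2%N
          & \sum_(B in pi) beta_of B = alpha]
    & forall beta : 'I_l -> 'M[nat]_(n, p),
        (forall s, msize (beta s) = 2%N) ->
        \sum_s beta s = alpha ->
        `|C_x P Z delta theta x beta [set: 'I_l]%SET|
        <= Ex_on P (fun w => `|x (Z w)|)
             (\bigcap_s Z @^-1` Omega delta theta (beta s))
           + \sum_(S : {set 'I_l} | S \proper [set: 'I_l]%SET)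
               `|C_x P Z delta theta x beta S| *
               fine (P (\bigcap_(s in [set s | s \notin S])
                          Z @^-1` Omega delta theta (beta s)))].
Proof.
have xL : (fun w => x (Z w)) \in Lfun P 1.
  by apply: Lfun_subset12 x_L2; rewrite fin_num_measure.
have delta1 i j z : `|delta i j z| <= 1.
  by have := delta_val i j z; rewrite !inE => /or3P[] /eqP ->;
    rewrite ?normrN ?normr1 ?normr0.
split.
- pose D (c : copies alpha) := delta (tag c).1 (tag c).2.
  pose th (c : copies alpha) := theta (tag c).1 (tag c).2.
  pose W (c : copies alpha) := signal Z delta theta nu (tag c).1 (tag c).2.
  pose Y (B : {set copies alpha}) w := delta_pow delta (beta_of B) (Z w) *
    \1_(Omega delta theta (beta_of B)) (Z w).
  (* Both moment identities required by [cumulant_pairing] come from here, with [f] equal to [x] and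
     to the constant 1. *)
  have wickf (f : {mfun Zt >-> R}) (A : {set copies alpha}) :
      (fun w => f (Z w)) \in Lfun P 1 ->
      mom1 P (fun w => f (Z w)) A W
      = lambda ^+ #|A| * \sum_(pi | pairing A pi) mom1 P (fun w => f (Z w)) pi Y.
    move=> fL; apply: (etrans (@wick _ _ _ _ _ P Z _ _ nu lambda D th f A
      (lt0r_neq0 lambda_gt0) nu_normal nu_indep nu_Z_indep
      (fun c => delta1 _ _) (fun c => theta_meas _ _) fL)).
    congr (_ * _); apply: eq_bigr => pi _; congr (Ex P _).
    apply/funext => w; congr (_ * _); apply: eq_bigr => B _.
    by rewrite /Y delta_pow_Omega.
  have mom11 (I : finType) (A : {set I}) (V : I -> T -> R) :
      mom P A V = mom1 P (fun w => (cst 1 : {mfun Zt >-> R}) (Z w)) A V.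
    by congr (Ex P _); apply/funext => w; rewrite mul1r.
  have := @cumulant_pairing _ _ lambda
    (fun A => Cum1 P (fun w => x (Z w)) A W)
    (fun A => mom1 P (fun w => x (Z w)) A W) (fun A => mom P A W)
    (fun pi => C_x P Z delta theta x (@beta_of n p alpha) pi)
    (fun pi => mom1 P (fun w => x (Z w)) pi Y) (fun pi => mom P pi Y)
    (fun A => mom1_Cum1 _ _ _ _) (fun pi => mom1_Cum1 _ _ _ _)
    (fun A => wickf x A xL).
  rewrite msize_copies => -> //; last exact: mom_set0.
    by congr (_ * _); apply: eq_bigl => pi; rewrite inE.
  move=> A; rewrite mom11 wickf; last exact: Lfun1_cst.
  by congr (_ * _); apply: eq_bigr => pi _; rewrite mom11.
- move=> pi; rewrite inE => piA; have /pairingP[pA pi2] := piA.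
  split; last by rewrite (sum_beta_of pA) beta_of_setT.
    have := pairing_card piA; rewrite -msize_copies alpha_size mulnC.
    by move=> /eqP; rewrite eqn_pmul2r // => /eqP.
  by move=> B Bpi; rewrite msize_beta_of pi2.
- move=> beta _ _; apply: Cum1_le => // [s|s|s w].
  + by apply: measurable_funPTI; exact: measurable_Omega.
  + apply: measurable_funM.
      apply: measurable_prod_cond => i _; apply: measurable_prod_cond => j _.
      by apply: measurable_funX; exact: measurableT_comp.
    apply: measurableT_comp => //; apply: measurable_indic.
    exact: measurable_Omega.
  (* The power of [delta] is at most 1 in absolute value, so the variable is dominated by the
     indicator of its [Omega]. *)
  + rewrite normrM -[leRHS]mul1r; apply: ler_pM => //.
      apply: normr_prod_le1 => i; apply: normr_prod_le1 => j.
      by rewrite normrX exprn_ile1.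
    rewrite !indicE (_ : (w \in _) = (Z w \in Omega delta theta (beta s))).
      by case: (_ \in _); rewrite ?normr1 ?normr0.
    by apply/idP/idP; rewrite !inE.
Qed.
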